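(* Let $G$ be a finite-dimensional Lie group, let $V$ be an $n$-dimensional real vector space, and let $\Phi:G\to \mathrm{Aut}(V)$ be a representation. Then the prolongation $\widetilde{\Phi}=\breve{Z}^{-1}\circ J_n\circ TZ\circ T\Phi: TG\to \mathrm{Aut}(TV)$ is a $2n$-dimensional real faithful (i.e. one-to-one) representation of the Lie group $TG$ on the $2n$-dimensional real vector space $TV$.
   Context: Representations are finite-dimensional and real: a representation of a Lie group $G$ on $V$ is a Lie group homomorphism $\Phi:G\to \mathrm{Aut}(V)$, where $\mathrm{Aut}(V)$ is the Lie group of linear automorphisms of $V$; it is faithful if it is one-to-one. $T$ denotes the tangent bundle of a manifold and the tangent map (differential) of a smooth map. $TG$ is a Lie group with multiplication $T\mu:TG\times TG\to TG$, where $\mu$ is the multiplication of $G$ and $T(G\times G)$ is identified with $TG\times TG$. Vector space structure on $TV$: for $X\in T_xV$, $Y\in T_yV$, $\lambda\in\mathbb{R}$, set $X\oplus Y=(T\tau_y)X+(T\tau_x)Y\in T_{x+y}V$ and $\lambda\bullet X=(T\sigma_\lambda)X\in T_{\lambda x}V$, where $\tau_x:V\to V$ is translation by $x$ and $\sigma_\lambda:V\to V$ is multiplication by $\lambda$. With these operations $TV$ is a real vector space of dimension $2n$. Bases: fix a basis $\{\alpha_1,\dots,\alpha_n\}$ of $V$ with associated linear coordinate functions $x_1,\dots,x_n$ on $V$, and let $e_1,\dots,e_n$ be the standard basis of $\mathbb{R}^n$. Let $\psi:TV\to V\times\mathbb{R}^n$, $\psi(v)=(p,\sum_i v[x_i]e_i)$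 for $v\in T_pV$. Put $\widetilde{\alpha}_i=\psi^{-1}(\alpha_i,0)$, $\widetilde{y}_i=\psi^{-1}(0,e_i)$; then $(\widetilde\alpha_1,\dots,\widetilde\alpha_n,\widetilde y_1,\dots,\widetilde y_n)$ is a basis of $TV$. Maps: $Z:\mathrm{Aut}(V)\to GL(n,\mathbb{R})$ sends an automorphism to its matrix with respect to $(\alpha_i)$, and $\breve Z:\mathrm{Aut}(TV)\to GL(2n,\mathbb{R})$ sends an automorphism to its matrix with respect to $(\widetilde\alpha_1,\dots,\widetilde\alpha_n,\widetilde y_1,\dots,\widetilde y_n)$. Every element of $T(GL(n,\mathbb{R}))$ at $a\in GL(n,\mathbb{R})$ is uniquely of the form $[a,B]:=TR_a(B)$ with $B\in \mathrm{Lie}(GL(n,\mathbb{R}))=T_eGL(n,\mathbb{R})$ and $R_a(y)=ya$. The one-to-one Lie group homomorphism $J_n:T(GL(n,\mathbb{R}))\to GL(2n,\mathbb{R})$ is $J_n([a,B])=\begin{pmatrix} a & 0\\ Ba & a\end{pmatrix}$. The prolongation of $\Phi$ to $TG$ is $\widetilde{\Phi}=\breve{Z}^{-1}\circ J_n\circ TZ\circ T\Phi$.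
   Formalization: The prolongation is claimed to be faithful only when the representation Φ is itself faithful; for a trivial Φ of a nontrivial G the prolongation is constant, so faithfulness fails. That it is a representation of TG on TV and that TV has dimension 2n are stated for every Φ. *)

(* Defs.v *)
From HB Require Import structures.
From mathcomp Require Import all_boot all_order all_algebra.
From mathcomp Require Import all_classical all_reals all_analysis.
Import numFieldNormedType.Exports.

Set Implicit Arguments.
Unset Strict Implicit.
Unset Printing Implicit Defensive.

Import Order.TTheory GRing.Theory Num.Theory VectorInternalTheory.
Local Open Scope classical_set_scope.
Local Open Scope ring_scope.

(* Meant for [U] open: [f] and all its iterated directional derivatives of
   order < k are (Frechet) differentiable on [U], those of order k are
   continuous on [U]. *)
Fixpoint Ck_on (R : realType) (a b k : nat) (U : set 'rV[R]_a)
    (f : 'rV[R]_a -> 'rV[R]_b) : Prop :=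
  match k with
  | 0 => forall x, U x -> {for x, continuous f}
  | k'.+1 => (forall x, U x -> differentiable f x) /\
             (forall v, Ck_on k' U (fun x => 'D_v f x))
  end.

Definition smooth_on (R : realType) (a b : nat) (U : set 'rV[R]_a)
    (f : 'rV[R]_a -> 'rV[R]_b) : Prop :=
  forall k, Ck_on k U f.

(* Raw data of an atlas.  [chart i] is relevant on [dom i] only, and
   [chartV i] on the image of [dom i] only.  The topology of the manifold is
   the one determined by the atlas ([mopen] below).  [chart_at x] is a
   preferred chart around [x]; it only serves to represent tangent vectors. *)
Record chartedSpace (R : realType) := ChartedSpace {
  carrier :> Type;
  mdim : nat;
  chart_index : Type;
  dom : chart_index -> set carrier;
  chart : chart_index -> carrier -> 'rV[R]_mdim;
  chartV : chart_index -> 'rV[R]_mdim -> carrier;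
  chart_at : carrier -> chart_index }.

Arguments mdim {R} c.
Arguments dom {R c} i.
Arguments chart {R c} i x.
Arguments chartV {R c} i z.
Arguments chart_at {R c} x.

Section Manifolds.
Context {R : realType}.
Implicit Types M N : chartedSpace R.

Definition mopen M (U : set M) : Prop :=
  forall i : chart_index M, open (chart i @` (dom i `&` U)).

Definition mhausdorff M : Prop :=
  forall x y : M, x <> y -> exists U V : set M,
    [/\ mopen U, mopen V, U x, V y & U `&` V = set0].

Definition msecond_countable M : Prop :=
  exists B : nat -> set M, (forall k, mopen (B k)) /\
    forall (U : set M) x, mopen U -> U x -> exists k, B k x /\ B k `<=` U.

Definition smooth_atlas M : Prop :=
  [/\ forall x : M, dom (chart_at x) x,
      forall (i : chart_index M) x, dom i x -> chartV i (chart i x) = x,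
      forall i : chart_index M, mopen (dom i)
    & forall i j : chart_index M,
        smooth_on (chart i @` (dom i `&` dom j)) (chart j \o chartV i)].

Definition smooth_manifold M : Prop :=
  [/\ smooth_atlas M, mhausdorff M & msecond_countable M].

(* The first conjunct amounts to the continuity of [f]. *)
Definition smooth_map M N (f : M -> N) : Prop :=
  forall (i : chart_index M) (j : chart_index N),
    open (chart i @` (dom i `&` f @^-1` dom j)) /\
    smooth_on (chart i @` (dom i `&` f @^-1` dom j))
              (chart j \o f \o chartV i).

Definition prod_space M N : chartedSpace R :=
  @ChartedSpace R (M * N)%type (mdim M + mdim N)%N
    (chart_index M * chart_index N)%type
    (fun ij => [set x | dom ij.1 x.1 /\ dom ij.2 x.2])
    (fun ij x => row_mx (chart ij.1 x.1) (chart ij.2 x.2))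
    (fun ij z => (chartV ij.1 (lsubmx z), chartV ij.2 (rsubmx z)))
    (fun x => (chart_at x.1, chart_at x.2)).

End Manifolds.

(* [vec X] lists the components of the tangent vector [X] in the preferred
   chart at its base point. *)
Record tangent (R : realType) (M : chartedSpace R) := Tangent {
  base : M;
  vec : 'rV[R]_(mdim M) }.

Arguments Tangent {R M} base vec.

Section TangentBundle.
Context {R : realType}.
Implicit Types M N : chartedSpace R.

Definition tmap M N (f : M -> N) (X : tangent M) : tangent N :=
  let i := chart_at (base X) in
  let j := chart_at (f (base X)) in
  Tangent (f (base X))
    ('d (chart j \o f \o chartV i) (chart i (base X)) (vec X)).

(* v[f] *)
Definition tder M (X : tangent M) (f : M -> R) : R :=
  let i := chart_at (base X) in
  'd (f \o chartV i : 'rV[R]_(mdim M) -> R^o) (chart i (base X)) (vec X).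

(* The chart of the tangent bundle induced by [chart i] maps a tangent vector
   to its base point and components, both read in [chart i]. *)
Definition tangent_space M : chartedSpace R :=
  @ChartedSpace R (tangent M) (mdim M + mdim M)%N (chart_index M)
    (fun i => [set X | dom i (base X)])
    (fun i X => let k := chart_at (base X) in
       row_mx (chart i (base X))
              ('d (chart i \o chartV k) (chart k (base X)) (vec X)))
    (fun i z => let x := chartV i (lsubmx z) in
       Tangent x
         ('d (chart (chart_at x) \o chartV i) (lsubmx z) (rsubmx z)))
    (fun X => chart_at (base X)).

(* The identification of TM x TN with T(M x N). *)
Definition tangent_pair M N (X : tangent M) (Y : tangent N) :
    tangent (prod_space M N) :=
  @Tangent R (prod_space M N) (base X, base Y) (row_mx (vec X) (vec Y)).

End TangentBundle.

Record lieData (R : realType) := LieData {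
  lie_space :> chartedSpace R;
  lie_mul : lie_space -> lie_space -> lie_space;
  lie_one : lie_space;
  lie_inv : lie_space -> lie_space }.

Arguments lie_mul {R l} x y.
Arguments lie_one {R} l.
Arguments lie_inv {R l} x.

Section LieGroups.
Context {R : realType}.

Definition lie_mul2 (G : lieData R) (p : prod_space G G) : G :=
  lie_mul p.1 p.2.

Definition lie_group (G : lieData R) : Prop :=
  [/\ smooth_manifold G,
      [/\ associative (@lie_mul R G), left_id (lie_one G) (@lie_mul R G)
        & left_inverse (lie_one G) (@lie_inv R G) (@lie_mul R G)],
      smooth_map (@lie_mul2 G)
    & smooth_map (@lie_inv R G)].

Definition tangent_lie (G : lieData R) : lieData R :=
  @LieData R (tangent_space G)
    (fun X Y => tmap (@lie_mul2 G) (tangent_pair X Y))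
    (Tangent (lie_one G) 0)
    (tmap (@lie_inv R G)).

End LieGroups.

Section VectorManifolds.
Context {R : realType}.

Definition vect_space (W : vectType R) : chartedSpace R :=
  @ChartedSpace R W (dim W) unit (fun=> setT) (fun=> v2r) (fun=> r2v)
    (fun=> tt).

(* Meant for [P] an open subset of [W]; [w0] is only a default value. *)
Definition open_space (W : vectType R) (P : pred W) (w0 : {w | P w}) :
    chartedSpace R :=
  @ChartedSpace R {w | P w} (dim W) unit (fun=> setT)
    (fun=> v2r \o val) (fun=> insubd w0 \o r2v) (fun=> tt).

End VectorManifolds.

Section Aut.
Context {R : realType}.
Implicit Type W : vectType R.

Definition is_aut W (f : 'End(W)) : bool := `[< bijective f >].

Definition aut W := {f : 'End(W) | is_aut f}.

Lemma aut_bij W (f : aut W) : bijective (val f).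
Proof. exact/asboolP/(valP f). Qed.

Lemma aut_one_subproof W : is_aut (\1%VF : 'End(W)).
Proof. by apply/asboolP; exists id => x; rewrite id_lfunE. Qed.

Definition aut_one W : aut W := exist (@is_aut W) _ (aut_one_subproof W).

Lemma aut_mul_subproof W (f g : aut W) :
  is_aut (val f \o val g)%VF.
Proof.
apply/asboolP; apply: (eq_bij (bij_comp (aut_bij f) (aut_bij g))) => x.
by rewrite comp_lfunE.
Qed.

Definition aut_mul W (f g : aut W) : aut W :=
  exist (@is_aut W) _ (aut_mul_subproof f g).

Lemma aut_lker0 W (f : aut W) : lker (val f) == 0%VS.
Proof. exact/lker0P/bij_inj/aut_bij. Qed.

Lemma aut_inv_subproof W (f : aut W) : is_aut ((val f)^-1)%VF.
Proof.
have f0 := aut_lker0 f.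
by apply/asboolP; exists (val f); [exact: lker0_lfunVK | exact: lker0_lfunK].
Qed.

Definition aut_inv W (f : aut W) : aut W :=
  exist (@is_aut W) _ (aut_inv_subproof f).

Definition aut_space W : chartedSpace R := open_space (aut_one W).

Definition aut_lie W : lieData R :=
  @LieData R (aut_space W) (@aut_mul W) (aut_one W) (@aut_inv W).

Definition representation (G : lieData R) W (Phi : G -> aut_lie W) : Prop :=
  [/\ lie_group G,
      forall x y, Phi (lie_mul x y) = lie_mul (Phi x) (Phi y)
    & smooth_map Phi].

End Aut.

Section GL.
Context {R : realType}.
Implicit Type n : nat.

Definition is_GL n (A : 'M[R]_n) : bool := A \in unitmx.

Definition GL n := {A : 'M[R]_n | is_GL A}.

Definition GL_one n : GL n := exist (@is_GL n) _ (unitmx1 R n).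

Lemma GL_mul_subproof n (A B : GL n) : val A *m val B \in unitmx.
Proof. by rewrite unitmx_mul; apply/andP; split; [exact: valP A|exact: valP B]. Qed.

Definition GL_mul n (A B : GL n) : GL n :=
  exist (@is_GL n) _ (GL_mul_subproof A B).

Lemma GL_inv_subproof n (A : GL n) : invmx (val A) \in unitmx.
Proof. by rewrite unitmx_inv; exact: valP A. Qed.

Definition GL_inv n (A : GL n) : GL n :=
  exist (@is_GL n) _ (GL_inv_subproof A).

Definition GL_space n : chartedSpace R :=
  open_space (GL_one n).

Definition GL_Rmul n (a : GL n) : GL_space n -> GL_space n :=
  fun y => GL_mul y a.

(* [a, B] = TR_a(B), a matrix [B] being seen as an element of T_e GL(n). *)
Definition GL_bracket n (a : GL n) (B : 'M[R]_n) : tangent (GL_space n) :=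
  tmap (GL_Rmul a) (@Tangent R (GL_space n) (GL_one n) (v2r B)).

(* The matrix [B] such that [X] = [a, B], where [a] is the base point of
   [X]: it is (TR_a)^-1 X = TR_(a^-1) X. *)
Definition GL_unbracket n (X : tangent (GL_space n)) : 'M[R]_n :=
  @r2v R 'M[R]_n (vec (tmap (GL_Rmul (GL_inv (base X))) X)).

Lemma J_subproof n (a : GL n) (B : 'M[R]_n) :
  block_mx (val a) 0 (B *m val a) (val a) \in unitmx.
Proof.
by rewrite unitmxE det_lblock unitrM -unitmxE; apply/andP; split; exact: valP a.
Qed.

Definition J n (X : tangent (GL_space n)) : GL (n + n) :=
  exist (@is_GL (n + n)) _ (J_subproof (base X) (GL_unbracket X)).

End GL.

Section TV.
Context {R : realType} (V : vectType R).

Definition TV := tangent (vect_space V).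

Definition translation (x : V) : vect_space V -> vect_space V :=
  fun y => (y : V) + x.
Definition homothety (l : R) : vect_space V -> vect_space V :=
  fun y => l *: (y : V).

(* (T tau_y) X and (T tau_x) Y are both tangent at x + y; they are added in
   that tangent space. *)
Definition TV_add (X Y : TV) : TV :=
  @Tangent R (vect_space V) ((base X : V) + (base Y : V))
    (vec (tmap (translation (base Y)) X) +
     vec (tmap (translation (base X)) Y)).

Definition TV_scale (l : R) (X : TV) : TV := tmap (homothety l) X.

End TV.

Section LinearDifferentials.
Context {R : realType}.

Lemma rV_linear_continuous (W : normedModType R) n (f : 'rV[R]_n -> W) :
  linear f -> continuous f.
Proof.
move=> flin.
pose fM := GRing.isLinear.Build _ _ _ _ _ flin.
pose fL : {linear 'rV[R]_n -> W} := HB.pack f fM.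
have -> : f = fun z : 'rV[R]_n => \sum_(i < n) z 0 i *: fL (delta_mx 0 i).
  apply/funext => z; rewrite -[f z]/(fL z) {1}(row_sum_delta z) linear_sum.
  by apply: eq_bigr => i _; rewrite linearZ.
have cD : continuous (fun x : W * W => x.1 + x.2) by exact: add_continuous.
apply: (continuous_big cD) => i _ z.
apply: cvgZ; [exact: (@nbhs_filter 'rV[R]_n) | |].
  exact: (@coord_continuous R 1 n 0 i z).
by apply: cvg_cst; exact: (@nbhs_filter 'rV[R]_n).
Qed.

Lemma rV_linear_diff (W : normedModType R) n (f : 'rV[R]_n -> W) x :
  linear f -> 'd f x = f :> ('rV[R]_n -> W).
Proof.
move=> flin.
pose fM := GRing.isLinear.Build _ _ _ _ _ flin.
pose fL : {linear 'rV[R]_n -> W} := HB.pack f fM.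
exact: (diff_lin x (rV_linear_continuous flin : continuous fL)).
Qed.

Lemma rV_translation_diff n (c x v : 'rV[R]_n) :
  'd (fun z : 'rV[R]_n => z + c) x v = v.
Proof.
have [_ ->] : is_diff x (fun z : 'rV[R]_n => z + c) id; last by [].
have -> : (fun z : 'rV[R]_n => z + c) = id + cst c by [].
by apply: is_diff_eq; rewrite addr0.
Qed.

End LinearDifferentials.

Section TVvect.
Context {R : realType} (V : vectType R).
Implicit Types (X Y : TV V) (l : R) (x : V).

Lemma vec_translation x X : vec (tmap (translation x) X) = vec X.
Proof.
have e : v2r \o translation x \o r2v =
    (fun z => z + v2r x) :> ('rV[R]_(dim V) -> 'rV[R]_(dim V)).
  by apply/funext => z; rewrite /= /translation linearD /= r2vK.
exact: etrans (congr1 (fun f => 'd f (v2r (base X)) (vec X)) e)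
  (rV_translation_diff _ _ _).
Qed.

Lemma vec_homothety l X : vec (tmap (homothety l) X) = l *: vec X.
Proof.
have hlin : linear (fun z : 'rV[R]_(dim V) => l *: z).
  by move=> a u v; rewrite scalerDr !scalerA mulrC.
have e : v2r \o homothety l \o r2v =
    (fun z => l *: z) :> ('rV[R]_(dim V) -> 'rV[R]_(dim V)).
  by apply/funext => z; rewrite /= /homothety linearZ /= r2vK.
exact: etrans (congr1 (fun f => 'd f (v2r (base X)) (vec X)) e)
  (congr1 (fun f => f (vec X)) (rV_linear_diff (v2r (base X)) hlin)).
Qed.

Definition mkTV x (u : 'rV[R]_(dim V)) : TV V := @Tangent R (vect_space V) x u.

Lemma TV_elim (P : TV V -> Prop) : (forall x u, P (mkTV x u)) -> forall X, P X.
Proof. by move=> h [x u]; exact: (h x u). Qed.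

Lemma TV_addE x y u v : TV_add (mkTV x u) (mkTV y v) = mkTV (x + y) (u + v).
Proof.
have ex := vec_translation y (mkTV x u).
have ey := vec_translation x (mkTV y v).
exact: (f_equal2 (fun a b : 'rV[R]_(dim V) => mkTV (x + y) (a + b)) ex ey).
Qed.

Lemma TV_scaleE l x u : TV_scale l (mkTV x u) = mkTV (l *: x) (l *: u).
Proof. exact: (f_equal (fun a : 'rV[R]_(dim V) => mkTV (l *: x) a)
  (vec_homothety l (mkTV x u))). Qed.

Definition TV_zero : TV V := mkTV 0 0.
Definition TV_opp X : TV V := TV_scale (-1) X.

Fact TV_addA : associative (@TV_add R V).
Proof. elim/TV_elim => x u; elim/TV_elim => y v; elim/TV_elim => z w.
by rewrite !TV_addE !addrA. Qed.

Fact TV_addC : commutative (@TV_add R V).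
Proof.
elim/TV_elim => x u; elim/TV_elim => y v.
by rewrite !TV_addE (addrC x) (addrC u).
Qed.

Fact TV_add0 : left_id TV_zero (@TV_add R V).
Proof. by elim/TV_elim => x u; rewrite TV_addE !add0r. Qed.

Fact TV_addN : left_inverse TV_zero TV_opp (@TV_add R V).
Proof.
by elim/TV_elim => x u; rewrite /TV_opp TV_scaleE TV_addE !scaleN1r !addNr.
Qed.

Fact TV_scaleA l k X : TV_scale l (TV_scale k X) = TV_scale (l * k) X.
Proof. by elim/TV_elim: X => x u; rewrite !TV_scaleE !scalerA. Qed.

Fact TV_scale1 : left_id 1 (@TV_scale R V).
Proof. by elim/TV_elim => x u; rewrite TV_scaleE !scale1r. Qed.

Fact TV_scaleDr : right_distributive (@TV_scale R V) (@TV_add R V).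
Proof.
move=> l; elim/TV_elim => x u; elim/TV_elim => y v.
by rewrite TV_addE !TV_scaleE TV_addE !scalerDr.
Qed.

Fact TV_scaleDl X :
  {morph (@TV_scale R V)^~ X : k l / k + l >-> TV_add k l}.
Proof.
by move=> k l; elim/TV_elim: X => x u; rewrite !TV_scaleE TV_addE !scalerDl.
Qed.

HB.instance Definition _ := gen_eqMixin (TV V).
HB.instance Definition _ := gen_choiceMixin (TV V).
HB.instance Definition _ :=
  GRing.isZmodule.Build (TV V) TV_addA TV_addC TV_add0 TV_addN.
HB.instance Definition _ :=
  GRing.Zmodule_isLmodule.Build R (TV V) TV_scaleA TV_scale1 TV_scaleDr
    TV_scaleDl.

Definition TV_v2r X : 'rV[R]_(dim V + dim V) :=
  row_mx (v2r (base X : V)) (vec X).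

Fact TV_v2r_linear : linear TV_v2r.
Proof.
move=> l; elim/TV_elim => x u; elim/TV_elim => y v.
rewrite -[l *: _]/(TV_scale l _) -[_ + _ in LHS]/(TV_add _ _).
rewrite TV_scaleE TV_addE /TV_v2r /= linearP.
by rewrite [in RHS]scale_row_mx add_row_mx.
Qed.

Fact TV_v2r_bij : bijective TV_v2r.
Proof.
exists (fun z : 'rV[R]_(dim V + dim V) => mkTV (r2v (lsubmx z)) (rsubmx z)).
  by elim/TV_elim => x u; rewrite /TV_v2r row_mxKl row_mxKr v2rK.
by move=> z; rewrite /TV_v2r /= r2vK hsubmxK.
Qed.

HB.instance Definition _ :=
  @Lmodule_hasFinDim.Build R (TV V) (dim V + dim V)
    (exist2 _ _ TV_v2r TV_v2r_linear TV_v2r_bij).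

End TVvect.

Section Bases.
Context {R : realType} (W : vectType R) (n : nat) (beta : n.-tuple W).
Implicit Types (f g : 'End(W)) (A B : 'M[R]_n).

(* Matrices act on columns: the j-th column of [mx_of f] lists the
   coordinates of the image under [f] of the j-th basis vector. *)
Definition mx_of f : 'M[R]_n := \matrix_(i, j) coord beta i (f beta`_j).

Definition lfun_of A : 'End(W) :=
  linfun (fun w => \sum_i (\sum_j A i j * coord beta j w) *: beta`_i).

(* The default values of [insubd] are not reached when [beta] is a basis: see
   [val_Zmx] and [val_ZmxV] below. *)
Definition Zmx (f : aut_space W) : GL_space n :=
  insubd (GL_one n) (mx_of (val f)).

Definition ZmxV (A : GL_space n) : aut_space W :=
  insubd (aut_one W) (lfun_of (val A)).

Hypothesis beta_basis : basis_of fullv beta.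

Lemma lfun_ofE A w :
  lfun_of A w = \sum_i (\sum_j A i j * coord beta j w) *: beta`_i.
Proof.
rewrite /lfun_of; set h := fun _ => _.
have hlin : linear h.
  move=> a u v; rewrite /h scaler_sumr -big_split /=; apply: eq_bigr => i _.
  rewrite scalerA -scalerDl mulr_sumr -big_split /=; congr (_ *: _).
  by apply: eq_bigr => j _; rewrite linearP mulrDr mulrCA.
pose hM := GRing.isLinear.Build _ _ _ _ _ hlin.
pose hL : {linear W -> W} := HB.pack h hM.
exact: (lfunE hL w).
Qed.

Lemma lfun_ofK : cancel lfun_of mx_of.
Proof.
move=> A; apply/matrixP => i j; have fb := basis_free beta_basis.
rewrite mxE lfun_ofE coord_sum_free // (bigD1 j) //= coord_free // eqxx mulr1.
rewrite big1 ?addr0 // => k kj.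
by rewrite coord_free // eq_sym (negbTE kj) mulr0.
Qed.

Lemma mx_ofK : cancel mx_of lfun_of.
Proof.
move=> f; apply/lfunP => w; rewrite lfun_ofE.
have wb u : u = \sum_i coord beta i u *: beta`_i.
  exact: coord_basis beta_basis (memvf u).
rewrite [in RHS](wb w) linear_sum [RHS]wb; apply: eq_bigr => i _.
congr (_ *: _); rewrite linear_sum; apply: eq_bigr => j _.
by rewrite mxE !linearZ mulrC.
Qed.

Lemma mx_of_comp f g : mx_of (f \o g)%VF = mx_of f *m mx_of g.
Proof.
apply/matrixP => i j; rewrite !mxE comp_lfunE.
rewrite [in LHS](coord_basis beta_basis (memvf (g beta`_j))) !linear_sum.
by apply: eq_bigr => k _; rewrite !mxE !linearZ mulrC.
Qed.

Lemma mx_of1 : mx_of \1%VF = 1%:M.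
Proof.
apply/matrixP => i j; rewrite !mxE id_lfunE.
by rewrite coord_free ?(basis_free beta_basis) // eq_sym.
Qed.

Lemma lfun_of_comp A B : (lfun_of A \o lfun_of B)%VF = lfun_of (A *m B).
Proof. by apply: (can_inj mx_ofK); rewrite mx_of_comp !lfun_ofK. Qed.

Lemma lfun_of1 : lfun_of 1%:M = \1%VF.
Proof. by apply: (can_inj mx_ofK); rewrite lfun_ofK mx_of1. Qed.

Lemma val_Zmx (f : aut_space W) : val (Zmx f) = mx_of (val f).
Proof.
rewrite /Zmx insubdK //; have f0 := aut_lker0 f.
have e : mx_of (val f) *m mx_of ((val f)^-1)%VF = 1%:M.
  by rewrite -mx_of_comp lker0_compfV // mx_of1.
by have [] := mulmx1_unit e.
Qed.

Lemma val_ZmxV (A : GL_space n) : val (ZmxV A) = lfun_of (val A).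
Proof.
rewrite /ZmxV insubdK //; apply/asboolP.
have Au : val A \in unitmx := valP A.
exists (lfun_of (invmx (val A))) => w.
  by rewrite -comp_lfunE lfun_of_comp mulVmx // lfun_of1 id_lfunE.
by rewrite -comp_lfunE lfun_of_comp mulmxV // lfun_of1 id_lfunE.
Qed.

Lemma ZmxK : cancel Zmx ZmxV.
Proof. by move=> f; apply: val_inj; rewrite val_ZmxV val_Zmx mx_ofK. Qed.

Lemma ZmxVK : cancel ZmxV Zmx.
Proof. by move=> A; apply: val_inj; rewrite val_Zmx val_ZmxV lfun_ofK. Qed.

End Bases.

Section TVbasis.
Context {R : realType} (V : vectType R) (n : nat) (alpha : n.-tuple V).

(* [tder X (coord alpha i)] is v[x_i]; [psiV] is the inverse of [psi]. *)
Definition psi (X : TV V) : V * 'rV[R]_n :=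
  (base X : V, \sum_i tder X (coord alpha i) *: delta_mx 0 i).

Definition psiV (pu : V * 'rV[R]_n) : TV V :=
  mkTV pu.1 (v2r (\sum_i pu.2 0 i *: alpha`_i)).

Definition TV_basis : (n + n).-tuple (TV V) :=
  cat_tuple [tuple psiV (tnth alpha i, 0) | i < n]
            [tuple psiV (0, delta_mx 0 i) | i < n].

Lemma tder_coord (X : TV V) i :
  tder X (coord alpha i) = coord alpha i (@r2v R V (vec X)).
Proof.
have clin : linear (fun z : 'rV[R]_(dim V) => coord alpha i (r2v z) : R^o).
  by move=> a u v; rewrite !linearP.
exact: (congr1 (fun f => f (vec X)) (rV_linear_diff (v2r (base X)) clin)).
Qed.

Hypothesis alpha_basis : basis_of fullv alpha.

Lemma psiK : cancel psi psiV.
Proof.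
apply: TV_elim => x u; rewrite /psi /psiV /=; congr (mkTV x _).
apply: r2v_inj; rewrite v2rK [RHS](coord_basis alpha_basis (memvf _)).
apply: eq_bigr => i _; congr (_ *: _); rewrite summxE (bigD1 i) //= !mxE !eqxx.
rewrite mulr1 tder_coord big1 ?addr0 // => j ji.
by rewrite !mxE eqxx eq_sym (negbTE ji) mulr0.
Qed.

Lemma psiVK : cancel psiV psi.
Proof.
move=> [p u]; rewrite /psi /psiV /=; congr (_, _).
rewrite [RHS]row_sum_delta; apply: eq_bigr => i _; congr (_ *: _).
by rewrite tder_coord /= v2rK coord_sum_free // (basis_free alpha_basis).
Qed.

Lemma psiV_linear : linear psiV.
Proof.
move=> a [p u] [q v]; rewrite -[a *: psiV _]/(TV_scale a _).
rewrite -[_ + _ in RHS]/(TV_add _ _) TV_scaleE TV_addE /psiV /=.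
congr mkTV; rewrite -linearP; congr v2r.
rewrite scaler_sumr -big_split /=; apply: eq_bigr => i _.
by rewrite !mxE scalerA scalerDl.
Qed.

Lemma TV_basis_basis : basis_of fullv TV_basis.
Proof.
have dV : dim V = n by rewrite -dimvf (size_basis alpha_basis).
have dTV : dim (TV V) = (n + n)%N by rewrite -[LHS]/(dim V + dim V)%N dV.
rewrite basisEdim size_tuple dimvf dTV leqnn andbT.
apply/subvP => X _; rewrite -(psiK X); move: (psi X) => [p u].
pose lM := GRing.isLinear.Build _ _ _ _ _ psiV_linear.
pose pL : {linear (V * 'rV[R]_n)%type -> TV V} := HB.pack psiV lM.
have -> : (p, u) = \sum_i coord alpha i p *: (alpha`_i, 0 : 'rV[R]_n) +
    \sum_i u 0 i *: (0 : V, delta_mx 0 i).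
  have m1 (F : 'I_n -> V * 'rV[R]_n) : (\sum_i F i).1 = \sum_i (F i).1.
    by elim/big_rec2: _ => //= i y x _ <-.
  have m2 (F : 'I_n -> V * 'rV[R]_n) : (\sum_i F i).2 = \sum_i (F i).2.
    by elim/big_rec2: _ => //= i y x _ <-.
  congr pair => /=; rewrite ?m1 ?m2 /=.
    rewrite [X in _ + X]big1 => [|i _]; last exact: scaler0.
    by rewrite addr0 [LHS](coord_basis alpha_basis (memvf p)).
  rewrite [X in X + _]big1 => [|i _]; last exact: scaler0.
  by rewrite add0r [LHS]row_sum_delta.
rewrite -[psiV _]/(pL _) linearD !linear_sum; apply: memvD; apply: memv_suml => i _.
  rewrite linearZ; apply/memvZ/memv_span; rewrite mem_cat; apply/orP; left.
  by apply/tnthP; exists i; rewrite tnth_mktuple (tnth_nth 0).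
rewrite linearZ; apply/memvZ/memv_span; rewrite mem_cat; apply/orP; right.
by apply/tnthP; exists i; rewrite tnth_mktuple.
Qed.

End TVbasis.

Section Jvalues.
Context {R : realType}.

Lemma near_linear_diff m n (f g : 'rV[R]_m -> 'rV[R]_n) x :
  linear g -> {near x, f =1 g} -> 'd f x = g :> ('rV[R]_m -> 'rV[R]_n).
Proof.
move=> glin fg.
pose gM := GRing.isLinear.Build _ _ _ _ _ glin.
pose gL : {linear 'rV[R]_m -> 'rV[R]_n} := HB.pack g gM.
apply: (@diff_unique _ _ _ f gL); first exact: (rV_linear_continuous glin).
apply/eqaddoP => e e0.
have := fg; rewrite near_simpl (near_shift 0) /= subr0; apply: filterS => h /= fgh.
rewrite /= !fctE /= fgh (nbhs_singleton fg) -[g (h + x)]/(gL _) linearD.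
rewrite -[g x]/(gL x) -[g h]/(gL h) (addrC (gL h)) subrr normr0.
by rewrite mulr_ge0 // ltW.
Qed.

Lemma det_continuous n : continuous (fun A : 'M[R]_n => \det A : R).
Proof.
have cD : continuous (fun x : R * R => x.1 + x.2) by exact: (@add_continuous R^o).
have cM : continuous (fun x : R * R => x.1 * x.2) by exact: mul_continuous.
rewrite /determinant; apply: (continuous_big cD) => s _ A.
apply: (@continuousM R _ (fun=> _)); first exact: cst_continuous.
apply: (continuous_big cM) => i _.
exact: coord_continuous.
Qed.

Lemma near_unitmx n (A : 'M[R]_n) : A \in unitmx ->
  \forall z \near v2r A, @r2v R 'M[R]_n z \in unitmx.
Proof.
move=> Au; have rc : continuous (@r2v R 'M[R]_n).
  by apply: rV_linear_continuous => k u w; rewrite linearP.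
have c : {for v2r A, continuous (fun z => \det (@r2v R 'M[R]_n z))}.
  by apply: continuous_comp; [exact: rc | exact: det_continuous].
have d0 : \det (@r2v R 'M[R]_n (v2r A)) != 0 by rewrite v2rK -unitfE -unitmxE.
have hF := @nbhs_filter 'rV[R]_(dim 'M[R]_n) (v2r A).
have := @cvgr_neq0 R R^o _ _ hF _ _ c d0.
by apply: filterS => z; rewrite unitmxE unitfE.
Qed.

Lemma GL_Rmul_diff n (a b : GL n) (v : 'rV[R]_(dim 'M[R]_n)) :
  vec (tmap (GL_Rmul a) (@Tangent R (GL_space n) b v)) =
  v2r (@r2v R 'M[R]_n v *m val a).
Proof.
pose g (z : 'rV[R]_(dim 'M[R]_n)) : 'rV[R]_(dim 'M[R]_n) :=
  v2r (@r2v R 'M[R]_n z *m val a).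
have glin : linear g by move=> k u w; rewrite /g !linearP /= mulmxDl -scalemxAl linearP.
suff e : {near v2r (val b),
    v2r \o val \o GL_Rmul a \o (insubd (GL_one n) \o r2v) =1 g}.
  exact: (congr1 (fun f => f v) (near_linear_diff glin e)).
apply: filterS (near_unitmx (valP b)) => z zu /=.
by rewrite /g; congr (v2r (_ *m _)); exact: insubdK.
Qed.

Lemma GL_unbracketK n (X : tangent (@GL_space R n)) :
  GL_bracket (base X) (GL_unbracket X) = X.
Proof.
case: X => a v; rewrite /GL_bracket /GL_unbracket GL_Rmul_diff v2rK.
have e := GL_Rmul_diff a (GL_one n)
  (v2r (@r2v R 'M[R]_n v *m val (GL_inv a))).
have b1 : GL_mul (GL_one n) a = a by apply: val_inj; exact: mul1mx.
have v1 : v2r (r2v (v2r (@r2v R 'M[R]_n v *m val (GL_inv a))) *m val a) = v.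
  by rewrite v2rK mulmxKV ?r2vK //; exact: valP a.
exact: (f_equal2 (@Tangent R (GL_space n)) b1 (etrans e v1)).
Qed.

Lemma J_bracket n (a : GL n) (B : 'M[R]_n) :
  val (J (GL_bracket a B)) = block_mx (val a) 0 (B *m val a) (val a).
Proof.
have ba : val (base (GL_bracket a B)) = val a by exact: mul1mx.
have vB : GL_unbracket (GL_bracket a B) = B.
  rewrite /GL_unbracket; case e : (GL_bracket a B) => [b v].
  have bE : val b = val a by rewrite -ba e.
  rewrite GL_Rmul_diff v2rK /= bE.
  have -> : v = v2r (B *m val a).
    have := congr1 (@vec R _) e; rewrite /GL_bracket GL_Rmul_diff v2rK.
    by move=> /= <-.
  by rewrite v2rK mulmxK //; exact: valP a.
rewrite -[LHS]/(block_mx (val (base (GL_bracket a B))) 0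
  (GL_unbracket (GL_bracket a B) *m val (base (GL_bracket a B)))
  (val (base (GL_bracket a B)))).
by rewrite ba vB.
Qed.

End Jvalues.

Definition prolongation (R : realType) (G : lieData R) (V : vectType R)
    (n : nat) (alpha : n.-tuple V) (Phi : G -> aut_lie V) :
    tangent_lie G -> aut_lie (TV V) :=
  ZmxV (TV_basis alpha) \o @J R n \o tmap (Zmx alpha) \o tmap Phi.

(* The hypothesis that [Phi] is one-to-one cannot be dropped when claiming
   that the prolongation is: trivial representations have trivial
   prolongations. *)
Lemma prolongation_cst (R : realType) (G : lieData R) (V : vectType R)
    (n : nat) (alpha : n.-tuple V) (f : aut_lie V) (X Y : tangent_lie G) :
  prolongation alpha (fun=> f) X = prolongation alpha (fun=> f) Y.
Proof.
have h (Z : tangent G) : tmap (fun=> f) Z = @Tangent R (aut_lie V) f 0.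
  apply: (f_equal (@Tangent R (aut_lie V) f)).
  exact: (congr1 (fun g => g (vec Z)) (diff_cst _ _)).
by rewrite /prolongation /= !h.
Qed.

(* Main.v *)
(* Identifying [J [a, B]] with the block matrix of a and the velocity Ba shows
   that the prolongation maps a tangent vector X at g to the matrix
   [[A, 0], [A', A]], where A = Z (Phi g) and A' is the derivative of Z o Phi
   along X.  Functoriality of T gives the group laws of TG, and the product rule
   turns multiplication in TG into multiplication of these block matrices.

   For injectivity it suffices to show that an injective homomorphism rho into
   GL(n) has an injective differential at 1.  Instead of integrating a left
   invariant field, suppose d rho (w) = 0 with w <> 0 small, and let g_N be the
   point of coordinates w / N in a chart centred at 1.  In this chart the product
   is x + y up to a small relative error, so g_N^N stays in a compact annulus
   around 1; but rho (g_N) = 1 + o(1/N), so rho (g_N^N) tends to 1.  By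
   compactness rho takes the value 1 on the annulus, against injectivity. *)

Require Import Defs.
From HB Require Import structures.
From mathcomp Require Import all_boot all_order all_algebra.
From mathcomp Require Import all_classical all_reals all_analysis.
From mathcomp Require Import ring lra.
Import numFieldNormedType.Exports.

Set Implicit Arguments.
Unset Strict Implicit.
Unset Printing Implicit Defensive.

Import Order.TTheory GRing.Theory Num.Theory VectorInternalTheory.
Local Open Scope classical_set_scope.
Local Open Scope ring_scope.

(* Failing unifications between differentials must not unfold [diff]. *)
Local Opaque diff.

(** * Smooth maps between open sets of R^a *)

Section SmoothCalculus.
Context {R : realType}.
Implicit Types a b c k : nat.

(** The estimate on the product must bound the error by half the size of the left factor alone,
    uniformly in the right factor. Each of the N steps multiplies on the left by g_N, of size |w|/N,
    so the errors add up to at most |w|/2; an error relative to both factors could grow like N|w|.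
    This is why x is moved with y fixed, and why the exact identity e y = y is used besides the
    differential. The differential is studied only at 1. Two tangent vectors X, Y with the same
    image, at whatever base points, reduce to this case because TG is itself a group and X^-1 Y has
    the image of the identity. A tangent vector is stored in the preferred chart of its base point,
    and this choice need not vary continuously. Smoothness of tangent maps is therefore derived from
    differentials in arbitrary pairs of charts. Chart inverses are unspecified off the chart images,
    so coordinate formulas are only compared near a point. *)

Lemma near_eq_differentiable (V W : normedModType R) (f g : V -> W) x :
  {near x, f =1 g} -> differentiable f x ->
  differentiable g x /\ 'd g x = 'd f x :> (V -> W).
Proof.
move=> fg /diff_locallyP [dc df].
have dg : g \o shift x = cst (g x) + 'd f x +o_ 0 id.
  apply/eqaddoP => e e0; move/eqaddoP : df => /(_ e e0).
  move: (fg); rewrite near_simpl (near_shift 0) /= subr0.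
  apply: filterS2 => h /= fgh.
  by rewrite !fctE /= fgh (nbhs_singleton fg).
have dgE := diff_unique dc dg.
split; last exact: dgE.
by apply/diff_locallyP; split; rewrite dgE; [exact: dc | exact: dg].
Qed.

Lemma rV_linear_differentiable a (W : normedModType R) (f : 'rV[R]_a -> W) x :
  linear f -> differentiable f x.
Proof.
move=> flin.
pose fM := GRing.isLinear.Build _ _ _ _ _ flin.
pose fL : {linear 'rV[R]_a -> W} := HB.pack f fM.
exact: (@linear_differentiable _ _ _ fL x (rV_linear_continuous flin)).
Qed.

Lemma open_near (T : topologicalType) (U : set T) x :
  open U -> U x -> \forall y \near x, U y.
Proof. by move=> Uo Ux; exact: open_nbhs_nbhs. Qed.

Lemma Ck_on_subset a b k (U W : set 'rV[R]_a) (f : 'rV[R]_a -> 'rV[R]_b) :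
  W `<=` U -> Ck_on k U f -> Ck_on k W f.
Proof.
move=> WU; elim: k f => [|k IH] f /=; first by move=> cf x /WU /cf.
by case=> df Df; split=> [x /WU /df //|v]; exact: IH.
Qed.

(** Derivatives are those of the total function [f], so [Ck_on] is a condition on each point of [U]
    separately; hence [W] may be any set containing the point. *)
Lemma Ck_on_local a b k (U : set 'rV[R]_a) (f : 'rV[R]_a -> 'rV[R]_b) :
  (forall x, U x -> exists2 W, W x & Ck_on k W f) -> Ck_on k U f.
Proof.
elim: k f => [|k IH] f /= lf.
  by move=> x /lf [W Wx cf]; exact: cf.
split=> [x /lf [W Wx [df _]]|v]; first exact: df.
by apply: IH => x /lf [W Wx [_ Df]]; exists W.
Qed.

Lemma eq_Ck_on a b k (U : set 'rV[R]_a) (f g : 'rV[R]_a -> 'rV[R]_b) :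
  open U -> (forall x, U x -> f x = g x) -> Ck_on k U f -> Ck_on k U g.
Proof.
move=> Uo; have nfg f' g' x : (forall x, U x -> f' x = g' x) -> U x ->
    {near x, f' =1 g' :> ('rV[R]_a -> 'rV[R]_b)}.
  by move=> fg Ux; apply: filterS (open_near Uo Ux) => y /fg.
elim: k f g => [|k IH] f g fg /=.
  move=> cf x Ux; have fx : f @ x --> f x := cf x Ux.
  suff : g @ x --> g x by [].
  rewrite -(fg _ Ux); apply: cvg_trans fx; apply: near_eq_cvg.
    exact: (@nbhs_filter 'rV[R]_a x).
  exact: (nfg _ _ _ fg Ux).
case=> df Df; split=> [x Ux|v].
  by have [] := near_eq_differentiable (nfg _ _ _ fg Ux) (df _ Ux).
apply: (IH _ _ _ (Df v)) => x Ux.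
by apply: near_eq_derive; exact: nfg.
Qed.

Lemma Ck_on_pred a b k (U : set 'rV[R]_a) (f : 'rV[R]_a -> 'rV[R]_b) :
  Ck_on k.+1 U f -> Ck_on k U f.
Proof.
elim: k f => [|k IH] f.
  by case=> df _ x Ux; exact/differentiable_continuous/df.
by case=> df Df; split=> // v; apply: IH; exact: Df.
Qed.

Lemma Ck_on_cst a b k (U : set 'rV[R]_a) (y : 'rV[R]_b) : Ck_on k U (cst y).
Proof.
elim: k y => [|k IH] y /=; first by move=> x _; exact: cst_continuous.
split=> [x _|v]; first exact: differentiable_cst.
have -> : (fun x : 'rV[R]_a => 'D_v (cst y) x) = cst 0 by apply/funext => x; rewrite derive_cst.
exact: IH.
Qed.

Lemma Ck_on_linear a b k (U : set 'rV[R]_a) (f : 'rV[R]_a -> 'rV[R]_b) :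
  linear f -> Ck_on k U f.
Proof.
move=> flin; case: k => [|k] /=; first by move=> x _; exact: rV_linear_continuous.
split=> [x _|v]; first exact: rV_linear_differentiable.
have -> : (fun x => 'D_v f x) = cst (f v).
  apply/funext => x; rewrite deriveE; last exact: rV_linear_differentiable.
  by rewrite rV_linear_diff.
exact: Ck_on_cst.
Qed.

Lemma Ck_onD a b k (U : set 'rV[R]_a) (f g : 'rV[R]_a -> 'rV[R]_b) :
  open U -> Ck_on k U f -> Ck_on k U g -> Ck_on k U (f + g).
Proof.
move=> Uo; elim: k f g => [|k IH] f g /=.
  by move=> cf cg x Ux; apply: continuousD; [exact: cf | exact: cg].
move=> [df Df] [dg Dg]; split=> [x Ux|v].
  by apply: differentiableD; [exact: df | exact: dg].
apply: eq_Ck_on (IH _ _ (Df v) (Dg v)) => // x Ux.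
by rewrite deriveD //; apply: diff_derivable; [exact: df | exact: dg].
Qed.

Lemma Ck_on_sum a b k (U : set 'rV[R]_a) (I : finType)
    (f : I -> 'rV[R]_a -> 'rV[R]_b) :
  open U -> (forall i, Ck_on k U (f i)) -> Ck_on k U (fun x => \sum_i f i x).
Proof.
move=> Uo cf.
have -> : (fun x => \sum_i f i x) = \sum_i f i.
  by apply/funext => x; elim/big_rec2: _ => //= i g h _ ->.
elim/big_rec: _ => [|i g _ cg]; first exact: Ck_on_cst.
exact: Ck_onD.
Qed.

Lemma diff_bilinear_comp (V U1 U2 W : normedModType R)
    (B : {bilinear U1 -> U2 -> W}) (f : V -> U1) (g : V -> U2) x :
  continuous (fun p => B p.1 p.2) -> differentiable f x -> differentiable g x ->
  differentiable (fun x => B (f x) (g x)) x /\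
  forall v, 'd (fun x => B (f x) (g x)) x v = B (f x) ('d g x v) + B ('d f x v) (g x).
Proof.
move=> Bc df dg; have dp := differentiable_pair df dg.
have dB := @differentiable_bilin _ _ _ _ B (f x, g x) Bc.
split; first exact: (differentiable_comp dp dB).
move=> v; have := congr1 (fun F => F v) (diff_comp dp dB).
by rewrite /= diff_pair //= diff_bilin.
Qed.

Lemma coord_scale_diff a b c (f : 'rV[R]_a -> 'rV[R]_b)
    (g : 'rV[R]_a -> 'rV[R]_c) (i : 'I_b) x :
  differentiable f x -> differentiable g x ->
  differentiable (fun x => f x 0 i *: g x) x /\
  forall v, 'd (fun x => f x 0 i *: g x) x v =
    f x 0 i *: 'd g x v + 'd f x v 0 i *: g x.
Proof.
move=> df dg.
pose F (u : 'rV[R]_b) (v : 'rV[R]_c) := u 0 i *: v.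
have Fbil : bilinear_for *:%R *:%R F.
  split=> [v l u w|u l v w] /=.
    by rewrite /F !mxE scalerDl scalerA.
  by rewrite /F scalerDr !scalerA mulrC.
pose FM := bilinear_isBilinear.Build R _ _ _ _ _ F Fbil.
pose FL : {bilinear 'rV[R]_b -> 'rV[R]_c -> 'rV[R]_c} := HB.pack F FM.
have Fc : continuous (fun p => FL p.1 p.2).
  move=> p; apply: (@cvgZ _ _ _ (nbhs p) _ (fun p => p.1 0 i) (fun p => p.2)).
    apply: (@continuous_comp _ _ _ fst (fun u : 'rV[R]_b => u 0 i)).
      exact: cvg_fst.
    exact: coord_continuous.
  exact: cvg_snd.
exact: (diff_bilinear_comp Fc df dg).
Qed.

(** The one product the calculus requires: sums of such terms express the chain rule and every
    bilinear map in coordinates. In each term of the product rule the undifferentiated factor is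
    lowered by one order with [Ck_on_pred]. *)
Lemma Ck_on_coord_scale a b c k (U : set 'rV[R]_a) (f : 'rV[R]_a -> 'rV[R]_b)
    (g : 'rV[R]_a -> 'rV[R]_c) (i : 'I_b) :
  open U -> Ck_on k U f -> Ck_on k U g -> Ck_on k U (fun x => f x 0 i *: g x).
Proof.
move=> Uo; elim: k f g => [|k IH] f g.
  move=> /= cf cg x Ux; apply: cvgZ; [exact: (@nbhs_filter 'rV[R]_a x) | | exact: cg].
  apply: (@continuous_comp _ _ _ f (fun u : 'rV[R]_b => u 0 i)); first exact: cf.
  exact: coord_continuous.
move=> Cf Cg; have [df Df] := Cf; have [dg Dg] := Cg; split=> [x Ux|v].
  by have [] := coord_scale_diff i (df _ Ux) (dg _ Ux).
have cf' := Ck_on_pred Cf; have cg' := Ck_on_pred Cg.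
apply: eq_Ck_on (Ck_onD Uo (IH _ _ cf' (Dg v)) (IH _ _ (Df v) cg')) => // x Ux.
have [dfg E] := coord_scale_diff i (df _ Ux) (dg _ Ux).
rewrite [RHS]deriveE // E -!deriveE //; [exact: df | exact: dg].
Qed.

Lemma diff_coordE a b (g : 'rV[R]_a -> 'rV[R]_b) y v : differentiable g y ->
  'd g y v = \sum_i v 0 i *: 'D_(delta_mx 0 i) g y.
Proof.
move=> dg; rewrite {1}[v]row_sum_delta linear_sum; apply: eq_bigr => i _.
by rewrite linearZ deriveE.
Qed.

(** D_v (g o f) is the sum over i of the i-th coordinate of D_v f times the i-th partial derivative
    of g taken at f; the induction hypothesis applies to the second factor. *)
Lemma Ck_on_comp a b c k (U : set 'rV[R]_a) (W : set 'rV[R]_b)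
    (f : 'rV[R]_a -> 'rV[R]_b) (g : 'rV[R]_b -> 'rV[R]_c) :
  open U -> (forall x, U x -> W (f x)) ->
  Ck_on k U f -> Ck_on k W g -> Ck_on k U (g \o f).
Proof.
move=> Uo UW; elim: k f g UW => [|k IH] f g UW.
  move=> /= cf cg x Ux; apply: continuous_comp; first exact: cf.
  by apply: cg; exact: UW.
move=> Cf [dg Dg]; have [df Df] := Cf; split=> [x Ux|v].
  by apply: differentiable_comp; [exact: df | exact/dg/UW].
have H : Ck_on k U (fun x =>
    \sum_i ('D_v f x) 0 i *: ('D_(delta_mx 0 i) g \o f) x).
  apply: Ck_on_sum => // i; apply: Ck_on_coord_scale (Df v) _ => //.
  exact: (IH _ _ UW (Ck_on_pred Cf) (Dg _)).
apply: eq_Ck_on H => // x Ux; have dfx := df _ Ux; have dgx := dg _ (UW _ Ux).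
rewrite [RHS]deriveE; last exact: differentiable_comp.
by rewrite diff_comp //= diff_coordE // deriveE.
Qed.

Lemma eq_smooth_on a b (U : set 'rV[R]_a) (f g : 'rV[R]_a -> 'rV[R]_b) :
  open U -> (forall x, U x -> f x = g x) -> smooth_on U f -> smooth_on U g.
Proof. by move=> Uo fg sf k; exact: eq_Ck_on (sf k). Qed.

Lemma smooth_on_local a b (U : set 'rV[R]_a) (f : 'rV[R]_a -> 'rV[R]_b) :
  (forall x, U x -> exists2 W, W x & smooth_on W f) -> smooth_on U f.
Proof. by move=> lf k; apply: Ck_on_local => x /lf [W Wx sf]; exists W. Qed.

Lemma smooth_on_subset a b (U W : set 'rV[R]_a) (f : 'rV[R]_a -> 'rV[R]_b) :
  W `<=` U -> smooth_on U f -> smooth_on W f.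
Proof. by move=> WU sf k; exact: Ck_on_subset (sf k). Qed.

Lemma smooth_on_linear a b (U : set 'rV[R]_a) (f : 'rV[R]_a -> 'rV[R]_b) :
  linear f -> smooth_on U f.
Proof. by move=> flin k; exact: Ck_on_linear. Qed.

Lemma smooth_onD a b (U : set 'rV[R]_a) (f g : 'rV[R]_a -> 'rV[R]_b) :
  open U -> smooth_on U f -> smooth_on U g -> smooth_on U (f + g).
Proof. by move=> Uo sf sg k; exact: Ck_onD. Qed.

Lemma smooth_on_comp a b c (U : set 'rV[R]_a) (W : set 'rV[R]_b)
    (f : 'rV[R]_a -> 'rV[R]_b) (g : 'rV[R]_b -> 'rV[R]_c) :
  open U -> (forall x, U x -> W (f x)) ->
  smooth_on U f -> smooth_on W g -> smooth_on U (g \o f).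
Proof. by move=> Uo UW sf sg k; exact: Ck_on_comp (sf k) (sg k). Qed.

Lemma smooth_on_differentiable a b (U : set 'rV[R]_a)
    (f : 'rV[R]_a -> 'rV[R]_b) x :
  smooth_on U f -> U x -> differentiable f x.
Proof. by move=> sf; have [df _] := sf 1; exact: df. Qed.

Lemma smooth_on_continuous a b (U : set 'rV[R]_a)
    (f : 'rV[R]_a -> 'rV[R]_b) x :
  smooth_on U f -> U x -> {for x, continuous f}.
Proof. by move=> sf; exact: (sf 0). Qed.

Lemma smooth_on_open_preimage a b (U : set 'rV[R]_a) (O : set 'rV[R]_b)
    (f : 'rV[R]_a -> 'rV[R]_b) :
  open U -> smooth_on U f -> open O -> open (U `&` f @^-1` O).
Proof.
move=> oU sf oO; rewrite openE => y [Uy Oy]; rewrite /interior.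
have cf : {for y, continuous f} by exact: smooth_on_continuous sf Uy.
have nO : \forall w \near y, O (f w) by apply: (cf O); exact: (open_near oO Oy).
by apply: filterS2 (open_near oU Uy) nO => w.
Qed.

Lemma lsubmx_linear b1 b2 : linear (@lsubmx R 1 b1 b2).
Proof. by move=> l u v; rewrite linearP. Qed.

Lemma rsubmx_linear b1 b2 : linear (@rsubmx R 1 b1 b2).
Proof. by move=> l u v; rewrite linearP. Qed.

Lemma open_lsubmx b1 b2 (U : set 'rV[R]_b1) :
  open U -> open [set z : 'rV[R]_(b1 + b2) | U (lsubmx z)].
Proof.
move=> Uo; apply: (@open_comp _ _ (@lsubmx R 1 b1 b2) U) => // z _.
exact: continuous_lsubmx.
Qed.

Lemma open_rsubmx b1 b2 (U : set 'rV[R]_b2) :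
  open U -> open [set z : 'rV[R]_(b1 + b2) | U (rsubmx z)].
Proof.
move=> Uo; apply: (@open_comp _ _ (@rsubmx R 1 b1 b2) U) => // z _.
exact: continuous_rsubmx.
Qed.

Lemma row_mxl_linear b1 b2 : linear (fun u : 'rV[R]_b1 => row_mx u (0 : 'rV[R]_b2)).
Proof. by move=> l u v; rewrite scale_row_mx add_row_mx scaler0 addr0. Qed.

Lemma row_mxr_linear b1 b2 : linear (fun u : 'rV[R]_b2 => row_mx (0 : 'rV[R]_b1) u).
Proof. by move=> l u v; rewrite scale_row_mx add_row_mx scaler0 addr0. Qed.

(** Pairing becomes a sum of composites with linear injections, and so inherits differentiability
    and smoothness from sums and composition. *)
Lemma row_mxE a b1 b2 (f : 'rV[R]_a -> 'rV[R]_b1) (g : 'rV[R]_a -> 'rV[R]_b2) :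
  (fun x => row_mx (f x) (g x)) =
  ((fun u => row_mx u 0) \o f) + ((fun u => row_mx 0 u) \o g).
Proof. by apply/funext => x; rewrite !fctE add_row_mx addr0 add0r. Qed.

Lemma diffDE (V W : normedModType R) (f g : V -> W) x v :
  differentiable f x -> differentiable g x ->
  'd (f + g) x v = 'd f x v + 'd g x v.
Proof. by move=> df dg; exact: (congr1 (fun h => h v) (diffD df dg)). Qed.

Lemma diff_linear_comp (V W : normedModType R) a (f : V -> 'rV[R]_a)
    (L : 'rV[R]_a -> W) x v :
  linear L -> differentiable f x -> 'd (L \o f) x v = L ('d f x v).
Proof.
move=> Llin df; have dL := rV_linear_differentiable (f x) Llin.
apply: (etrans (congr1 (fun h => h v) (diff_comp df dL))).
by rewrite /= (rV_linear_diff _ Llin).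
Qed.

Lemma diff_row_mx a b1 b2 (f : 'rV[R]_a -> 'rV[R]_b1)
    (g : 'rV[R]_a -> 'rV[R]_b2) x :
  differentiable f x -> differentiable g x ->
  differentiable (fun x => row_mx (f x) (g x)) x /\
  forall v, 'd (fun x => row_mx (f x) (g x)) x v = row_mx ('d f x v) ('d g x v).
Proof.
move=> df dg; rewrite row_mxE.
have dl y := rV_linear_differentiable y (@row_mxl_linear b1 b2).
have dr y := rV_linear_differentiable y (@row_mxr_linear b1 b2).
have dl' := differentiable_comp df (dl (f x)).
have dr' := differentiable_comp dg (dr (g x)).
split; first exact: differentiableD.
move=> v.
have El := diff_linear_comp v (@row_mxl_linear b1 b2) df.
have Er := diff_linear_comp v (@row_mxr_linear b1 b2) dg.
apply: (etrans (diffDE v dl' dr')).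
apply: (etrans (f_equal2 +%R El Er)).
by rewrite add_row_mx addr0 add0r.
Qed.

Lemma smooth_on_row_mx a b1 b2 (U : set 'rV[R]_a) (f : 'rV[R]_a -> 'rV[R]_b1)
    (g : 'rV[R]_a -> 'rV[R]_b2) :
  open U -> smooth_on U f -> smooth_on U g ->
  smooth_on U (fun x => row_mx (f x) (g x)).
Proof.
move=> Uo sf sg; rewrite row_mxE; apply: smooth_onD => //.
  by apply: smooth_on_comp (smooth_on_linear setT (@row_mxl_linear _ _)).
by apply: smooth_on_comp (smooth_on_linear setT (@row_mxr_linear _ _)).
Qed.

(** The differential at x along v is the sum of v_i times the i-th partial derivative at x, so order
    k here costs order k + 1 for [f]. *)
Lemma smooth_on_diff a b (U : set 'rV[R]_a) (f : 'rV[R]_a -> 'rV[R]_b) :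
  open U -> smooth_on U f ->
  smooth_on [set z : 'rV[R]_(a + a) | U (lsubmx z)]
    (fun z => 'd f (lsubmx z) (rsubmx z)).
Proof.
move=> Uo sf k.
have U'o := @open_lsubmx a a _ Uo.
have H : Ck_on k [set z : 'rV[R]_(a + a) | U (lsubmx z)]
    (fun z => \sum_i (rsubmx z) 0 i *: ('D_(delta_mx 0 i) f \o lsubmx) z).
  apply: Ck_on_sum => // i; apply: Ck_on_coord_scale => //.
    exact/Ck_on_linear/rsubmx_linear.
  apply: (Ck_on_comp (W := U)) => //; first exact/Ck_on_linear/lsubmx_linear.
  by have [_] := sf k.+1; exact.
apply: eq_Ck_on H => // z Uz.
by rewrite diff_coordE //; exact: smooth_on_differentiable sf _.
Qed.

End SmoothCalculus.

(** * Manifolds *)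

Section SmoothMaps.
Context {R : realType}.
Implicit Types M N P : chartedSpace R.

(** The tangent map read in arbitrary charts: [tmap] is the case of preferred charts, and [mdiff id]
    is the differential of a change of charts. *)
Definition mdiff M N (f : M -> N) i j (x : M) (v : 'rV[R]_(mdim M)) :
  'rV[R]_(mdim N) := 'd (chart j \o f \o chartV i) (chart i x) v.

Definition ldom M N (f : M -> N) (i : chart_index M) (j : chart_index N) :=
  chart i @` (dom i `&` f @^-1` dom j).

(** With the converse [smooth_atlasP], compatibility of charts becomes smoothness of the identity,
    and transition maps become instances of smooth maps. *)
Lemma smooth_atlas_id M : smooth_atlas M -> smooth_map (id : M -> M).
Proof. by case=> _ _ od sm i j; split; [exact: od | exact: sm]. Qed.

Lemma smooth_atlasP M : (forall x : M, dom (chart_at x) x) ->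
  (forall (i : chart_index M) x, dom i x -> chartV i (chart i x) = x) ->
  smooth_map (id : M -> M) -> smooth_atlas M.
Proof. by move=> c l s; split=> // i j; have [] := s i j; have [] := s j i. Qed.

Lemma chart_atP M (x : M) : smooth_atlas M -> dom (chart_at x) x.
Proof. by case. Qed.

Lemma chartK M i (x : M) : smooth_atlas M -> dom i x -> chartV i (chart i x) = x.
Proof. by case=> _ + _ _; exact. Qed.

Lemma ldom_chart M N (f : M -> N) i j x : dom i x -> dom j (f x) ->
  ldom f i j (chart i x).
Proof. by move=> ix jx; exists x. Qed.

Lemma ldomP M N (f : M -> N) i j z : smooth_atlas M -> ldom f i j z ->
  [/\ chart i (chartV i z) = z, dom i (chartV i z) & dom j (f (chartV i z))].
Proof. by move=> aM [x [ix jx] <-]; rewrite chartK. Qed.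

Lemma lrep_differentiable M N (f : M -> N) i j x : smooth_map f ->
  dom i x -> dom j (f x) -> differentiable (chart j \o f \o chartV i) (chart i x).
Proof.
move=> sf ix jx; have [_ s] := sf i j.
by apply: (smooth_on_differentiable s); exact: ldom_chart.
Qed.

Lemma near_ldom M N (f : M -> N) i j x : smooth_map f ->
  dom i x -> dom j (f x) -> \forall z \near chart i x, ldom f i j z.
Proof.
by move=> sf ix jx; apply: open_near; [have [] := sf i j | exact: ldom_chart].
Qed.

Lemma mdiff_comp M N P (f : M -> N) (g : N -> P) i j k x v :
  smooth_atlas M -> smooth_atlas N -> smooth_map f -> smooth_map g ->
  dom i x -> dom j (f x) -> dom k (g (f x)) ->
  mdiff g j k (f x) (mdiff f i j x v) = mdiff (g \o f) i k x v.
Proof.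
move=> aM aN sf sg ix jx kx; rewrite /mdiff.
set F := chart j \o f \o chartV i; set G := chart k \o g \o chartV j.
have dF : differentiable F (chart i x) by exact: lrep_differentiable.
have Fx : F (chart i x) = chart j (f x) by rewrite /F /= chartK.
have dG : differentiable G (F (chart i x)).
  by rewrite Fx; exact: lrep_differentiable.
have e : {near chart i x, G \o F =1 chart k \o (g \o f) \o chartV i}.
  apply: filterS (near_ldom sf ix jx) => z /(ldomP aM) [_ _ jz].
  by rewrite /G /F /= (chartK aN jz).
have [_ E] := near_eq_differentiable e (differentiable_comp dF dG).
have E2 := diff_comp dF dG.
symmetry; apply: (etrans (congr1 (fun h => h v) E)).
by apply: (etrans (congr1 (fun h => h v) E2)); rewrite /= Fx.
Qed.

Lemma mdiff_id M i (x : M) v : smooth_atlas M -> dom i x ->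
  mdiff (id : M -> M) i i x v = v.
Proof.
move=> aM ix; have idlin : linear (id : 'rV[R]_(mdim M) -> _) by [].
have e : {near chart i x, chart i \o (id : M -> M) \o chartV i =1 id}.
  apply: filterS (near_ldom (smooth_atlas_id aM) ix ix) => z.
  by case/(ldomP aM).
exact: (congr1 (fun h => h v) (near_linear_diff idlin e)).
Qed.

Lemma mdiff_idK M i k (x : M) v : smooth_atlas M -> dom i x -> dom k x ->
  mdiff (id : M -> M) k i x (mdiff (id : M -> M) i k x v) = v.
Proof.
move=> aM ix kx; have sI := smooth_atlas_id aM.
by rewrite (mdiff_comp v aM aM sI sI ix kx ix) mdiff_id.
Qed.

Lemma smooth_map_comp M N P (f : M -> N) (g : N -> P) :
  smooth_atlas M -> smooth_atlas N -> smooth_map f -> smooth_map g ->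
  smooth_map (g \o f).
Proof.
move=> aM aN sf sg i k.
(* One chart of N need not cover the image of f, so the middle chart is chosen for each z and
   smoothness is glued from the neighbourhoods [W]. *)
have loc z : ldom (g \o f) i k z -> exists W : set 'rV[R]_(mdim M),
    [/\ open W, W z, W `<=` ldom (g \o f) i k &
      smooth_on W (chart k \o (g \o f) \o chartV i)].
  move=> /(ldomP aM) [ez iz kz]; set x := chartV i z in ez iz kz.
  set j := chart_at (f x); have jx : dom j (f x) by exact: chart_atP.
  have [oA sF] := sf i j; have [oB sG] := sg j k.
  rewrite -/(ldom f i j) in oA sF; rewrite -/(ldom g j k) in oB sG.
  set F := chart j \o f \o chartV i in sF.
  have oW : open (ldom f i j `&` F @^-1` ldom g j k).
    exact: smooth_on_open_preimage.
  exists (ldom f i j `&` F @^-1` ldom g j k); split=> //.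
  - split; first by rewrite -ez; exact: ldom_chart.
    by rewrite /F /= -/x; exact: ldom_chart.
  - move=> w [/(ldomP aM) [ew iw jw] /(ldomP aN) [_ _]].
    rewrite /F /= (chartK aN jw) => kw.
    by rewrite -ew; apply: ldom_chart.
  - have sW : smooth_on (ldom f i j `&` F @^-1` ldom g j k) F.
      by apply: smooth_on_subset sF => w [].
    apply: (eq_smooth_on oW _ (smooth_on_comp oW _ sW sG)); last by move=> w [].
    by move=> w [/(ldomP aM) [_ _ jw] _]; rewrite /F /= (chartK aN jw).
split.
  rewrite openE => z /loc [W [oW Wz WU _]].
  by rewrite /interior; apply: filterS WU (open_near oW Wz).
by apply: smooth_on_local => z /loc [W [_ Wz _ sW]]; exists W.
Qed.

Lemma smooth_map_cst M N (y : N) : smooth_atlas M -> smooth_atlas N ->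
  smooth_map (fun _ : M => y).
Proof.
move=> aM aN i j; have cst_smooth U : smooth_on U
    (chart j \o (fun _ : M => y) \o chartV i) by move=> k; exact: Ck_on_cst.
split=> //; have [jy|jy] := pselect (dom j y); last first.
  rewrite (_ : _ @` _ = set0); first exact: open0.
  by apply/seteqP; split=> // z [x []].
rewrite openE => _ [x [ix _] <-]; rewrite /interior.
have := near_ldom (smooth_atlas_id aM) ix ix.
by apply: filterS => _ [w [iw _] <-]; exists w.
Qed.

Lemma mdiff_cst M N (y : N) i j (x : M) v : mdiff (fun _ : M => y) i j x v = 0.
Proof. exact: (congr1 (fun h => h v) (diff_cst (chart j y) (chart i x))). Qed.

Lemma prod_ldom M N P (f : M -> N) (g : M -> P) i j k : smooth_atlas M ->
  ldom (N := prod_space N P) (fun x => (f x, g x)) i (j, k) =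
  ldom f i j `&` ldom g i k.
Proof.
move=> aM; apply/seteqP; split=> [_ [x [ix [jx kx]] <-]|z].
  by split; exact: ldom_chart.
case=> /(ldomP aM) [ez iz jz] /(ldomP aM) [_ _ kz].
by rewrite -ez; apply: ldom_chart.
Qed.

Lemma smooth_map_pair M N P (f : M -> N) (g : M -> P) : smooth_atlas M ->
  smooth_map f -> smooth_map g ->
  smooth_map (N := prod_space N P) (fun x => (f x, g x)).
Proof.
move=> aM sf sg i [j k]; have := prod_ldom f g i j k aM; rewrite {1}/ldom => ->.
have [oA sF] := sf i j; have [oB sG] := sg i k.
have oW : open (ldom f i j `&` ldom g i k) by exact: openI.
split=> //; apply: (@smooth_on_row_mx _ _ _ _ _
   (chart j \o f \o chartV i) (chart k \o g \o chartV i)) => //.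
  by apply: smooth_on_subset sF => z [].
by apply: smooth_on_subset sG => z [].
Qed.

Lemma mdiff_pair M N P (f : M -> N) (g : M -> P) i j k x v :
  smooth_map f -> smooth_map g -> dom i x -> dom j (f x) -> dom k (g x) ->
  mdiff (N := prod_space N P) (fun x => (f x, g x)) i (j, k) x v =
  row_mx (mdiff f i j x v) (mdiff g i k x v).
Proof.
move=> sf sg ix jx kx.
have [_ E] := diff_row_mx (lrep_differentiable sf ix jx)
  (lrep_differentiable sg ix kx).
exact: E.
Qed.

Lemma smooth_map_fst M N : smooth_atlas M -> smooth_atlas N ->
  smooth_map (M := prod_space M N) fst.
Proof.
move=> aM aN [i i'] j; have [oA sF] := smooth_atlas_id aM i j.
have [oB _] := smooth_atlas_id aN i' i'.
set U := _ @` _; have -> : U =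
    [set z | ldom (id : M -> M) i j (lsubmx z)] `&`
    [set z | ldom (id : N -> N) i' i' (rsubmx z)].
  apply/seteqP; split=> [_ [[x y] [[/= ix iy] jx] <-]|z].
    by rewrite /= row_mxKl row_mxKr; split; exact: ldom_chart.
  move=> /= [/(ldomP aM) [ez iz jz] /(ldomP aN) [ez' iz' jz']].
  exists (chartV i (lsubmx z), chartV i' (rsubmx z)) => //=.
  by rewrite ez ez' hsubmxK.
have oU := openI (open_lsubmx (b2 := mdim N) oA) (open_rsubmx (b1 := mdim M) oB).
split=> //.
apply: (smooth_on_comp (W := ldom (id : M -> M) i j) oU _ _ sF) => [z []//|].
exact/smooth_on_linear/lsubmx_linear.
Qed.

Lemma smooth_map_snd M N : smooth_atlas M -> smooth_atlas N ->
  smooth_map (M := prod_space M N) snd.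
Proof.
move=> aM aN [i' i] j; have [oA sF] := smooth_atlas_id aN i j.
have [oB _] := smooth_atlas_id aM i' i'.
set U := _ @` _; have -> : U =
    [set z | ldom (id : M -> M) i' i' (lsubmx z)] `&`
    [set z | ldom (id : N -> N) i j (rsubmx z)].
  apply/seteqP; split=> [_ [[x y] [[/= ix iy] jx] <-]|z].
    by rewrite /= row_mxKl row_mxKr; split; exact: ldom_chart.
  move=> /= [/(ldomP aM) [ez iz jz] /(ldomP aN) [ez' iz' jz']].
  exists (chartV i' (lsubmx z), chartV i (rsubmx z)) => //=.
  by rewrite ez ez' hsubmxK.
have oU := openI (open_lsubmx (b2 := mdim N) oB) (open_rsubmx (b1 := mdim M) oA).
split=> //.
apply: (smooth_on_comp (W := ldom (id : N -> N) i j) oU _ _ sF) => [z []//|].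
exact/smooth_on_linear/rsubmx_linear.
Qed.

Lemma prod_atlas M N : smooth_atlas M -> smooth_atlas N ->
  smooth_atlas (prod_space M N).
Proof.
move=> aM aN; have l : forall (i : chart_index (prod_space M N)) x,
    dom i x -> chartV i (chart i x) = x.
  by move=> [i j] [x y] [/= ix jy]; rewrite row_mxKl row_mxKr !chartK.
(* [smooth_map_pair] would presuppose the atlas of the product; the identity is paired by hand from
   the two projections, already known to be smooth. *)
have sid : smooth_map (id : prod_space M N -> prod_space M N).
  move=> [i i'] [j j'].
  have [oA sF] := smooth_map_fst aM aN (i, i') j.
  have [oB sG] := smooth_map_snd aM aN (i, i') j'.
  set U := _ @` _; have UE : U =
     ldom (M := prod_space M N) fst (i, i') j `&`
     ldom (M := prod_space M N) snd (i, i') j'.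
    apply/seteqP; split=> [_ [[x y] [[/= ix iy] [/= jx jy]] <-]|z].
      by split; exists (x, y).
    (* The two memberships come with possibly different points having the same coordinates;
       injectivity of the chart i' identifies y' with y. *)
    case=> -[[x y] [/= ii jx] <-] [[x' y'] [/= [ix' iy'] jy'] /eq_row_mx [e1 e2]].
    exists (x, y) => //; split=> //; split=> //=; case: ii => ix iy.
    by rewrite -(chartK aN iy) -e2 (chartK aN).
  rewrite UE; have oU := openI oA oB; split=> //.
  apply: (@smooth_on_row_mx _ _ _ _ _
    (chart j \o fst \o chartV (c := prod_space M N) (i, i'))
    (chart j' \o snd \o chartV (c := prod_space M N) (i, i'))) => //.
    by apply: smooth_on_subset sF => z [].
  by apply: smooth_on_subset sG => z [].
apply: smooth_atlasP => // -[x y]; split; exact: chart_atP.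
Qed.

Lemma mdiff_fst M N i i' j (x : prod_space M N) v :
  smooth_atlas M -> dom i x.1 -> dom j x.1 ->
  mdiff (M := prod_space M N) fst (i, i') j x v =
  mdiff (id : M -> M) i j x.1 (lsubmx v).
Proof.
move=> aM ix jx; have d := lrep_differentiable (smooth_atlas_id aM) ix jx.
have e : chart i x.1 = lsubmx (chart (c := prod_space M N) (i, i') x).
  by rewrite /= row_mxKl.
rewrite /mdiff e in d *.
have dl := rV_linear_differentiable (chart (c := prod_space M N) (i, i') x) (@lsubmx_linear R (mdim M) (mdim N)).
apply: (etrans (congr1 (fun h => h v) (diff_comp dl d))).
by rewrite /= (rV_linear_diff _ (@lsubmx_linear R _ _)).
Qed.

Lemma mdiff_snd M N i i' j (x : prod_space M N) v :
  smooth_atlas N -> dom i x.2 -> dom j x.2 ->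
  mdiff (M := prod_space M N) snd (i', i) j x v =
  mdiff (id : N -> N) i j x.2 (rsubmx v).
Proof.
move=> aN ix jx; have d := lrep_differentiable (smooth_atlas_id aN) ix jx.
have e : chart i x.2 = rsubmx (chart (c := prod_space M N) (i', i) x).
  by rewrite /= row_mxKr.
rewrite /mdiff e in d *.
have dr := rV_linear_differentiable (chart (c := prod_space M N) (i', i) x) (@rsubmx_linear R (mdim M) (mdim N)).
apply: (etrans (congr1 (fun h => h v) (diff_comp dr d))).
by rewrite /= (rV_linear_diff _ (@rsubmx_linear R _ _)).
Qed.

End SmoothMaps.

(** * The tangent functor *)

Section TangentFunctor.
Context {R : realType}.
Implicit Types M N P : chartedSpace R.

Lemma tmapE M N (f : M -> N) (X : tangent M) :
  tmap f X = Tangent (f (base X))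
    (mdiff f (chart_at (base X)) (chart_at (f (base X))) (base X) (vec X)).
Proof. by []. Qed.

Lemma tchartE M (i : chart_index M) (X : tangent M) : chart (c := tangent_space M) i X =
  row_mx (chart i (base X)) (mdiff (id : M -> M) (chart_at (base X)) i (base X) (vec X)).
Proof. by []. Qed.

Lemma tchartV_row M (i : chart_index M) (x : M) (w : 'rV[R]_(mdim M)) : smooth_atlas M -> dom i x ->
  chartV (c := tangent_space M) i (row_mx (chart i x) w) =
  Tangent x (mdiff (id : M -> M) i (chart_at x) x w).
Proof. by move=> aM ix; rewrite /= row_mxKl row_mxKr chartK. Qed.

Lemma tchart_row M (i : chart_index M) (x : M) (w : 'rV[R]_(mdim M)) : smooth_atlas M -> dom i x ->
  chart (c := tangent_space M) i (Tangent x (mdiff (id : M -> M) i (chart_at x) x w)) =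
  row_mx (chart i x) w.
Proof.
by move=> aM ix; rewrite tchartE /= mdiff_idK //; exact: chart_atP.
Qed.

Lemma tchartK M (i : chart_index M) (X : tangent M) : smooth_atlas M -> dom i (base X) ->
  chartV (c := tangent_space M) i (chart (c := tangent_space M) i X) = X.
Proof.
case: X => x v aM ix; rewrite /= in ix.
by rewrite tchartE tchartV_row //= mdiff_idK //; exact: chart_atP.
Qed.

(** The preferred charts cancel by the chain rule, leaving (x, v) -> (F x, dF_x v) with F the
    expression of f in the charts i and j. *)
Lemma tchart_tmap M N (f : M -> N) (i : chart_index M) (j : chart_index N) (X : tangent M) :
  smooth_atlas M -> smooth_atlas N -> smooth_map f ->
  dom i (base X) -> dom j (f (base X)) ->
  chart (c := tangent_space N) j (tmap f X) = row_mx (chart j (f (base X)))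
    (mdiff f i j (base X) (rsubmx (chart (c := tangent_space M) i X))).
Proof.
case: X => x v aM aN sf ix jx; rewrite /= in ix jx; have sM := smooth_atlas_id aM.
have sN := smooth_atlas_id aN; have kx := chart_atP x aM.
have kfx := chart_atP (f x) aN.
rewrite tmapE tchartE row_mxKr /=; congr row_mx.
rewrite (mdiff_comp v aM aN sf sN kx kfx jx).
exact/esym/(mdiff_comp v aM aM sM sf kx ix jx).
Qed.

Lemma tangent_ldom M N (f : M -> N) (i : chart_index M) (j : chart_index N) : smooth_atlas M ->
  ldom (M := tangent_space M) (N := tangent_space N) (tmap f) i j =
  [set z | ldom f i j (lsubmx z)].
Proof.
move=> aM; apply/seteqP; split=> [_ [[x v] [/= ix jx] <-]|z /= [x [ix jx] e]].
  by rewrite /= row_mxKl; exact: ldom_chart.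
exists (Tangent x (mdiff (id : M -> M) i (chart_at x) x (rsubmx z))) => //.
by rewrite tchart_row // e hsubmxK.
Qed.

Lemma smooth_tmap M N (f : M -> N) : smooth_atlas M -> smooth_atlas N ->
  smooth_map f -> smooth_map (M := tangent_space M) (N := tangent_space N) (tmap f).
Proof.
move=> aM aN sf i j; have := tangent_ldom f i j aM; rewrite {1}/ldom => ->.
have [oA sF] := sf i j; rewrite -/(ldom f i j) in oA sF.
set F := chart (c := N) j \o f \o chartV (c := M) i in sF.
have oW := open_lsubmx (b2 := mdim M) oA; split=> //.
have sl : smooth_on [set z | ldom (M := M) (N := N) f i j (lsubmx z)]
    (F \o @lsubmx R 1 (mdim M) (mdim M)).
  apply: smooth_on_comp oW _ _ sF => //; exact/smooth_on_linear/lsubmx_linear.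
apply: (eq_smooth_on oW _ (smooth_on_row_mx oW sl (smooth_on_diff oA sF))).
move=> z [x [ix jx] e].
rewrite -[RHS]/(chart (c := tangent_space N) j
  (tmap f (chartV (c := tangent_space M) i z))).
rewrite -[z in RHS]hsubmxK -e.
have xX : base (Tangent x (mdiff (id : M -> M) i (chart_at x) x (rsubmx z))) = x by [].
rewrite tchartV_row // (@tchart_tmap M N f i j _ aM aN sf) //.
by rewrite tchart_row // row_mxKr /= -e /F /= (chartK aM ix).
Qed.

Lemma tmap_id M (X : tangent M) : smooth_atlas M -> tmap (id : M -> M) X = X.
Proof.
by case: X => x v aM; rewrite tmapE /= mdiff_id //; exact: chart_atP.
Qed.

Lemma tmap_comp M N P (f : M -> N) (g : N -> P) X :
  smooth_atlas M -> smooth_atlas N -> smooth_atlas P ->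
  smooth_map f -> smooth_map g -> tmap g (tmap f X) = tmap (g \o f) X.
Proof.
move=> aM aN aP sf sg; rewrite !tmapE /=; congr Tangent.
by apply: mdiff_comp => //; exact: chart_atP.
Qed.

Lemma tmap_cst M N (y : N) (X : tangent M) : tmap (fun _ : M => y) X = Tangent y 0.
Proof. by rewrite tmapE mdiff_cst. Qed.

(** Changes of charts of TM are the coordinate expressions of T id = id. There is no circularity:
    [smooth_tmap] rests on the atlas of M alone. *)
Lemma tangent_atlas M : smooth_atlas M -> smooth_atlas (tangent_space M).
Proof.
move=> aM; apply: smooth_atlasP => [X|i X iX|].
- exact: (chart_atP (base X) aM).
- exact: (@tchartK M i X).
- have := smooth_tmap aM aM (smooth_atlas_id aM).
  by rewrite (_ : tmap _ = id) //; apply/funext => X; exact: tmap_id.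
Qed.

Lemma tmap_pair M N P (f : M -> N) (g : M -> P) X :
  smooth_atlas M -> smooth_atlas N -> smooth_atlas P ->
  smooth_map f -> smooth_map g ->
  tangent_pair (tmap f X) (tmap g X) =
  tmap (N := prod_space N P) (fun x => (f x, g x)) X.
Proof.
move=> aM aN aP sf sg; rewrite !tmapE /tangent_pair /=; congr Tangent.
by symmetry; apply: mdiff_pair => //; exact: chart_atP.
Qed.

Lemma tmap_fst M N (X : tangent M) (Y : tangent N) : smooth_atlas M ->
  tmap (M := prod_space M N) fst (tangent_pair X Y) = X.
Proof.
case: X Y => [x v] [y w] aM; rewrite tmapE /=.
have kx := chart_atP x aM.
by rewrite (@mdiff_fst _ M N _ _ _ (x, y)) //= row_mxKl mdiff_id.
Qed.

Lemma tmap_snd M N (X : tangent M) (Y : tangent N) : smooth_atlas N ->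
  tmap (M := prod_space M N) snd (tangent_pair X Y) = Y.
Proof.
case: X Y => [x v] [y w] aN; rewrite tmapE /=.
have ky := chart_atP y aN.
by rewrite (@mdiff_snd _ M N _ _ _ (x, y)) //= row_mxKr mdiff_id.
Qed.

(** Turns the coordinates ((x, v), (y, w)) of TM x TN into the coordinates ((x, y), (v, w)) of T(M x
    N). *)
Definition row_shuffle m n (z : 'rV[R]_(m + m + (n + n))) :
    'rV[R]_(m + n + (m + n)) :=
  row_mx (row_mx (lsubmx (lsubmx z)) (lsubmx (rsubmx z)))
         (row_mx (rsubmx (lsubmx z)) (rsubmx (rsubmx z))).

Lemma row_shuffle_linear m n : linear (@row_shuffle m n).
Proof.
by move=> l u v; rewrite /row_shuffle !linearP /= !scale_row_mx !add_row_mx.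
Qed.

Lemma tchart_pair M N (i : chart_index M) (j : chart_index N) (X : tangent M) (Y : tangent N) :
  smooth_atlas M -> smooth_atlas N -> dom i (base X) -> dom j (base Y) ->
  chart (c := tangent_space (prod_space M N)) (i, j) (tangent_pair X Y) =
  row_shuffle (chart (c := prod_space (tangent_space M) (tangent_space N)) (i, j) (X, Y)).
Proof.
case: X Y => [x v] [y w] aM aN ix jy; rewrite /= in ix jy.
have kx := chart_atP x aM; have ky := chart_atP y aN.
have aMN := prod_atlas aM aN.
have := @mdiff_pair _ (prod_space M N) _ _ _ _ (chart_at x, chart_at y) i j (x, y)
  (row_mx v w) (smooth_map_fst aM aN) (smooth_map_snd aM aN) (conj kx ky) ix jy.
rewrite mdiff_fst // mdiff_snd //= row_mxKl row_mxKr => E.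
rewrite /row_shuffle /= !(row_mxKl, row_mxKr).
exact: (congr1 (row_mx (row_mx (chart i x) (chart j y))) E).
Qed.

(** In coordinates this is a change of charts on TM x TN followed by the linear [row_shuffle]. *)
Lemma smooth_tangent_pair M N : smooth_atlas M -> smooth_atlas N ->
  smooth_map (M := prod_space (tangent_space M) (tangent_space N))
    (N := tangent_space (prod_space M N)) (fun p => tangent_pair p.1 p.2).
Proof.
move=> aM aN [i i'] [j j'].
have aT := prod_atlas (tangent_atlas aM) (tangent_atlas aN).
have [oU sU] := smooth_atlas_id aT (i, i') (j, j'); split=> //.
apply: (eq_smooth_on oU _ (smooth_on_comp (W := setT) oU _ sU _)) => //.
  move=> _ [[X Y] [ii [jX jY]] <-] /=.
  have e := chartK aT ii.
  apply: etrans (congr1 (fun p => chart (c := tangent_space (prod_space M N))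
    (j, j') (tangent_pair p.1 p.2)) (esym e)).
  rewrite [RHS]tchart_pair //=.
  exact: (congr1 (fun p => row_shuffle
    (chart (c := prod_space (tangent_space M) (tangent_space N)) (j,j') p)) e).
exact/smooth_on_linear/row_shuffle_linear.
Qed.

End TangentFunctor.

(** * The tangent group *)

Section TangentManifold.
Context {R : realType}.
Implicit Types M N : chartedSpace R.

Lemma mopen_chart M (i : chart_index M) (O : set 'rV[R]_(mdim M)) :
  smooth_atlas M -> open O -> mopen [set x | dom i x /\ O (chart i x)].
Proof.
move=> aM oO j; have [oA sF] := smooth_atlas_id aM j i.
rewrite (_ : _ @` _ = ldom (id : M -> M) j i `&`
  (chart i \o (id : M -> M) \o chartV j) @^-1` O).
  exact: smooth_on_open_preimage.
apply/seteqP; split=> [_ [x [jx [ix Ox]] <-]|_ [[x [jx ix] <-] Ox]].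
  by split; [exact: ldom_chart | rewrite /= (chartK aM jx)].
by exists x => //; split=> //; split=> //; rewrite /= (chartK aM jx) in Ox.
Qed.

Lemma mopen_base M (U : set M) : smooth_atlas M -> mopen U ->
  mopen (M := tangent_space M) (@base R M @^-1` U).
Proof.
move=> aM oU i; rewrite (_ : _ @` _ =
  [set z | (chart (c := M) i @` (dom (c := M) i `&` U)) (lsubmx z)]).
  exact: (open_lsubmx (oU i)).
apply/seteqP; split=> [_ [[x v] [/= ix Ux] <-]|z /= [x [ix Ux] e]].
  by rewrite /= row_mxKl; exists x.
exists (Tangent x (mdiff (id : M -> M) i (chart_at x) x (rsubmx z))) => //.
by apply: (etrans (@tchart_row _ M i x _ aM ix)); rewrite e hsubmxK.
Qed.

(** Vectors at the same point lie in a common chart of TM and are separated by their coordinates;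
    vectors at distinct points are separated through the projection to M. *)
Lemma tangent_hausdorff M : smooth_atlas M -> mhausdorff M ->
  mhausdorff (tangent_space M).
Proof.
move=> aM hM X Y XY; have [bXY|/hM [U [V [oU oV UX VY UV]]]] := pselect (base X = base Y).
  set i := chart_at (base X) : chart_index (tangent_space M).
  have iX : dom i X by exact: (chart_atP (base X) aM).
  have iY : dom i Y by rewrite /= -bXY.
  have aT := tangent_atlas aM.
  have cXY : chart i X != chart i Y.
    by apply/eqP => e; apply: XY; rewrite -(chartK aT iX) e (chartK aT iY).
  have := @norm_hausdorff R 'rV[R]_(mdim (tangent_space M)).
  rewrite open_hausdorff => /(_ _ _ cXY) [[A B] [/= Ax By] [oA oB AB]].
  exists [set Z | dom i Z /\ A (chart i Z)], [set Z | dom i Z /\ B (chart i Z)].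
  split.
  - exact: mopen_chart.
  - exact: mopen_chart.
  - by split=> //; rewrite inE in Ax.
  - by split=> //; rewrite inE in By.
  - rewrite predeqE => Z; split=> // -[[_ AZ] [_ BZ]].
    by have : (A `&` B) (chart i Z) by []; rewrite (eqP AB).
exists (@base R M @^-1` U), (@base R M @^-1` V); split=> //; try exact: mopen_base.
rewrite predeqE => Z; split=> // -[UZ VZ].
by have : (U `&` V) (base Z) by []; rewrite UV.
Qed.

Lemma rV_countable_base n : exists B : nat -> set 'rV[R]_n,
  (forall k, open (B k)) /\
  forall (U : set 'rV[R]_n) x, open U -> U x -> exists k, B k x /\ B k `<=` U.
Proof.
pose C (p : 'rV[rat]_n * nat) : set 'rV[R]_n :=
  ball (map_mx ratr p.1 : 'rV[R]_n) (p.2.+1%:R^-1).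
exists (fun k => if unpickle k is Some p then C p else set0); split=> [k|U x oU Ux].
  case: unpickle => [p|]; last exact: open0.
  by apply: ball_open; rewrite invr_gt0.
have /nbhs_ballP [e /= e0 eU] := open_near oU Ux.
(* All points of a ball of radius 1/(k+1) that contains x are within 2/(k+1) < e of x. *)
have [k ke] : exists k : nat, k.+1%:R^-1 < e / 2.
  have e2 : 0 < e / 2 by rewrite divr_gt0.
  by have [k _ ke] := near_infty_natSinv_lt (PosNum e2); exists k; exact: (ke k (leqnn k)).
have k0 : 0 < k.+1%:R^-1 :> R by rewrite invr_gt0.
have q j : exists q : rat, `|x 0 j - ratr q| < k.+1%:R^-1.
  have xk : x 0 j - k.+1%:R^-1 < x 0 j + k.+1%:R^-1 by rewrite ltrD2l gtrN.
  have [q qI] := rat_in_itvoo xk; exists q; move: qI; rewrite in_itv /= => /andP[ql qr].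
  by rewrite ltr_distlC ql.
pose c : 'rV[rat]_n := \row_j sval (cid (q j)).
have Cx : C (c, k) x.
  split=> // i j; rewrite ord1 !mxE /ball /= distrC.
  exact: svalP (cid (q j)).
exists (pickle (c, k)); rewrite pickleK; split=> // y Cy; apply: eU.
have Cx' : ball x k.+1%:R^-1 (map_mx ratr c : 'rV[R]_n) by exact/ball_sym.
apply: le_ball (ball_triangle Cx' Cy).
by rewrite [leRHS]splitr lerD // ltW.
Qed.

Lemma mopen0 M : mopen (set0 : set M).
Proof. by move=> i; rewrite setI0 image_set0; exact: open0. Qed.

(* A countable base selects countably many charts whose domains cover [M]; the
   pullbacks of a countable base of the model space along their tangent charts
   form a base of the tangent bundle. *)
Lemma tangent_second_countable M : smooth_atlas M -> msecond_countable M ->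
  msecond_countable (tangent_space M).
Proof.
move=> aM [B [oB bB]]; have aT := tangent_atlas aM.
have [C [oC bC]] := rV_countable_base (mdim (tangent_space M)).
pose W (k l : nat) : set (tangent_space M) :=
  match pselect (exists i : chart_index M, B k `<=` dom i) with
  | left h => let i := projT1 (cid h) : chart_index (tangent_space M) in
      [set X | dom i X /\ C l (chart i X)]
  | right _ => set0
  end.
exists (fun m => if unpickle m is Some kl then W kl.1 kl.2 else set0); split=> [m|U X oU UX].
  case: unpickle => [[k l]|]; last exact: mopen0.
  rewrite /W /=; case: pselect => [h|_]; last exact: mopen0.
  exact: mopen_chart.
have iX := chart_atP (base X) aM; have [_ _ od _] := aM.
have [k [BX Bi]] := bB _ _ (od (chart_at (base X))) iX.
have h : exists i : chart_index M, B k `<=` dom i by exists (chart_at (base X)).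
(* The chart selected for [B k] may differ from the preferred one at [base X]; only the inclusion of
   [B k] in its domain is used. *)
case Ei : (pselect (exists i : chart_index M, B k `<=` dom i)) => [h'|//].
set i := projT1 (cid h') : chart_index (tangent_space M).
have {}iX : dom i X by exact: (projT2 (cid h') _ BX).
have [l [Cl lU]] : exists l, C l (chart i X) /\ C l `<=` chart i @` (dom i `&` U).
  by apply: bC; [exact: oU | exists X].
exists (pickle (k, l)); rewrite pickleK /W Ei /=; split=> // Y [iY CY].
have [Z [iZ UZ] e] := lU _ CY.
have -> : Y = Z; last exact: UZ.
apply: (etrans (esym (chartK aT iY))); apply: etrans (chartK aT iZ).
exact: (congr1 (chartV i) (esym e)).
Qed.

Lemma tangent_manifold M : smooth_manifold M -> smooth_manifold (tangent_space M).
Proof.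
case=> aM hM cM; split; [exact: tangent_atlas | exact: tangent_hausdorff |].
exact: tangent_second_countable.
Qed.

End TangentManifold.

(** * Transfer of the group laws from G to TG *)

Section TangentGroup.
Context {R : realType} (G : lieData R).
Hypothesis Glie : lie_group G.

Lemma lie_atlas : smooth_atlas G.
Proof. by case: Glie => -[]. Qed.

(** The device that carries identities from G to TG: once the factors are images of one tangent
    vector under maps into G, products in TG come from pointwise products of these maps. *)
Lemma tangent_mul_tmap (M : chartedSpace R) (f g : M -> G) X : smooth_atlas M ->
  smooth_map f -> smooth_map g ->
  lie_mul (l := tangent_lie G) (tmap f X) (tmap g X) =
  tmap (fun x => lie_mul (f x) (g x)) X.
Proof.
move=> aM sf sg; have aG := lie_atlas; have [_ _ sm _] := Glie.
rewrite -[LHS]/(tmap (@lie_mul2 R G) (tangent_pair (tmap f X) (tmap g X))).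
rewrite (tmap_pair _ aM aG aG sf sg).
by rewrite (tmap_comp _ aM (prod_atlas aG aG) aG (smooth_map_pair aM sf sg) sm).
Qed.

Lemma smooth_map_mul (M : chartedSpace R) (f g : M -> G) : smooth_atlas M ->
  smooth_map f -> smooth_map g -> smooth_map (fun x => lie_mul (f x) (g x)).
Proof.
move=> aM sf sg; have aG := lie_atlas; have [_ _ sm _] := Glie.
exact: (smooth_map_comp aM (prod_atlas aG aG) (smooth_map_pair aM sf sg) sm).
Qed.

Lemma tangent_lie_group : lie_group (tangent_lie G).
Proof.
have aG := lie_atlas; have [mG [mA m1 mV] sm sv] := Glie.
have aT := tangent_atlas aG; have aGG := prod_atlas aG aG.
have sI := smooth_atlas_id aG.
split; first exact: tangent_manifold.
- split=> [X Y Z|X|X].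
  + have aP := prod_atlas aGG aG.
    (* X, Y and Z are the images under the three projections of this one vector tangent to G x G x
       G, so associativity is only needed pointwise in G. *)
    pose W := tangent_pair (M := prod_space G G) (tangent_pair X Y) Z.
    have s12 := smooth_map_fst aGG aG.
    pose p1 (x : prod_space (prod_space G G) G) : G := x.1.1.
    pose p2 (x : prod_space (prod_space G G) G) : G := x.1.2.
    have s1 : smooth_map p1 := smooth_map_comp aP aGG s12 (smooth_map_fst aG aG).
    have s2 : smooth_map p2 := smooth_map_comp aP aGG s12 (smooth_map_snd aG aG).
    pose p3 (x : prod_space (prod_space G G) G) : G := x.2.
    have s3 : smooth_map p3 := smooth_map_snd aGG aG.
    have eX : tmap p1 W = X.
      apply: (etrans (esym (tmap_comp W aP aGG aG s12 (smooth_map_fst aG aG)))).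
      by rewrite tmap_fst // tmap_fst.
    have eY : tmap p2 W = Y.
      apply: (etrans (esym (tmap_comp W aP aGG aG s12 (smooth_map_snd aG aG)))).
      by rewrite tmap_fst // tmap_snd.
    have eZ : tmap p3 W = Z by exact: tmap_snd.
    rewrite -eX -eY -eZ.
    have e23 := tangent_mul_tmap W aP s2 s3.
    have e1_23 := tangent_mul_tmap W aP s1 (smooth_map_mul aP s2 s3).
    have e12 := tangent_mul_tmap W aP s1 s2.
    have e12_3 := tangent_mul_tmap W aP (smooth_map_mul aP s1 s2) s3.
    apply: (etrans (congr1 (lie_mul (l := tangent_lie G) (tmap p1 W)) e23)).
    apply: (etrans e1_23); symmetry.
    apply: (etrans (f_equal2 (lie_mul (l := tangent_lie G)) e12 (erefl (tmap p3 W)))).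
    apply: (etrans e12_3).
    by congr (tmap _ W); apply/funext => x; rewrite mA.
  + have e1 : lie_one (tangent_lie G) = tmap (fun _ : G => lie_one G) X.
      by rewrite tmap_cst.
    have eX := tmap_id X aG.
    apply: (etrans (f_equal2 (lie_mul (l := tangent_lie G)) e1 (esym eX))).
    apply: (etrans (tangent_mul_tmap X aG (smooth_map_cst _ aG aG) sI)).
    apply: etrans eX.
    by congr (tmap _ X); apply/funext => x; rewrite m1.
  + have eX := tmap_id X aG.
    apply: (etrans (congr1 (lie_mul (l := tangent_lie G) (tmap lie_inv X)) (esym eX))).
    apply: (etrans (tangent_mul_tmap X aG sv sI)).
    apply: etrans (tmap_cst (M := G) (lie_one G) X).
    by congr (tmap _ X); apply/funext => x; rewrite mV.
- exact: (smooth_map_comp (prod_atlas aT aT) (tangent_atlas aGG)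
    (smooth_tangent_pair aG aG) (smooth_tmap aGG aG sm)).
- exact: smooth_tmap.
Qed.

End TangentGroup.

(** * Linear groups *)

Section OpenSubspaces.
Context {R : realType}.

(** The target has one chart, defined everywhere, so a smooth coordinate formula in each chart of M
    is enough. The formula may extend beyond the chart image, which avoids the default values of
    [insubd]. *)
Lemma smooth_to_open_space (M : chartedSpace R) (W : vectType R) (P : pred W)
    (w0 : {w | P w}) (f : M -> open_space w0)
    (L : chart_index M -> 'rV[R]_(mdim M) -> 'rV[R]_(dim W)) :
  smooth_atlas M -> (forall i, smooth_on setT (L i)) ->
  (forall i x, dom i x -> v2r (val (f x)) = L i (chart i x)) -> smooth_map f.
Proof.
move=> aM sL fL i j; have [oU _] := smooth_atlas_id aM i i.
have e : chart i @` (dom i `&` f @^-1` dom j) = ldom (id : M -> M) i i.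
  by apply/seteqP; split=> _ [x [ix _] <-]; exists x.
rewrite e; split=> //.
apply: (eq_smooth_on oU _ (smooth_on_subset (@subsetT _ _) (sL i))).
by move=> z /(ldomP aM) [ez iz _]; rewrite -{1}ez -fL.
Qed.

Lemma open_space_atlas (W : vectType R) (P : pred W) (w0 : {w | P w}) :
  open [set z : 'rV[R]_(dim W) | P (r2v z)] -> smooth_atlas (open_space w0).
Proof.
move=> oP; have l : forall (i : chart_index (open_space w0)) x,
    dom i x -> chartV i (chart i x) = x.
  by move=> i x _; rewrite /= v2rK; apply: val_inj; rewrite insubdK //; exact: valP x.
apply: smooth_atlasP => // i j.
have e : chart i @` (dom i `&` (id : open_space w0 -> open_space w0) @^-1` dom j) =
    [set z | P (r2v z)].
  apply/seteqP; split=> [_ [x _ <-]|z Pz]; first by rewrite /= v2rK; exact: valP x.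
  by exists (exist (fun w => P w) (@r2v R W z) Pz) => //=; rewrite r2vK.
rewrite e; split=> //.
have idlin : linear (id : 'rV[R]_(dim W) -> 'rV[R]_(dim W)) by [].
apply: (eq_smooth_on oP _ (smooth_on_linear _ idlin)) => z Pz.
by rewrite /= insubdK // r2vK.
Qed.

Lemma open_is_GL n : open [set z : 'rV[R]_(dim 'M[R]_n) | @is_GL R n (r2v z)].
Proof.
rewrite openE => z /= zu; rewrite /interior.
by have := near_unitmx zu; rewrite r2vK.
Qed.

Lemma GL_atlas n : smooth_atlas (@GL_space R n).
Proof. exact/open_space_atlas/open_is_GL. Qed.

Section Matrices.
Context (W : vectType R) (n : nat) (beta : n.-tuple W).
Hypothesis beta_basis : basis_of fullv beta.

Lemma mx_of_linear : linear (mx_of beta).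
Proof.
move=> l f g; apply/matrixP => i j.
by rewrite !mxE add_lfunE scale_lfunE linearP.
Qed.

Lemma lfun_of_linear : linear (lfun_of beta).
Proof.
move=> l A B; apply: (can_inj (mx_ofK beta_basis)).
by rewrite mx_of_linear !lfun_ofK.
Qed.

Lemma v2r_mx_of_linear : linear (fun z : 'rV[R]_(dim 'End(W)) =>
  v2r (mx_of beta (r2v z)) : 'rV[R]_(dim 'M[R]_n)).
Proof. by move=> l u v; rewrite linearP mx_of_linear linearP. Qed.

Lemma v2r_lfun_of_linear : linear (fun z : 'rV[R]_(dim 'M[R]_n) =>
  v2r (lfun_of beta (r2v z)) : 'rV[R]_(dim 'End(W))).
Proof. by move=> l u v; rewrite linearP lfun_of_linear linearP. Qed.

Lemma is_autE f : is_aut f = (mx_of beta f \in unitmx).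
Proof.
apply/idP/idP => fu.
  by have := valP (Zmx beta (exist (@is_aut R W) f fu)); rewrite /is_GL val_Zmx.
have := valP (ZmxV beta (exist (@is_GL R n) _ fu)).
by rewrite val_ZmxV //= mx_ofK.
Qed.

Lemma aut_atlas : smooth_atlas (aut_space W).
Proof.
apply: open_space_atlas.
have -> : [set z : 'rV[R]_(dim 'End(W)) | is_aut (r2v z)] =
    (fun z => v2r (mx_of beta (r2v z))) @^-1` [set z | @is_GL R n (r2v z)].
  by apply/seteqP; split=> z /=; rewrite is_autE // v2rK.
apply: open_comp (@open_is_GL n) => z _.
exact: rV_linear_continuous v2r_mx_of_linear _.
Qed.

Lemma smooth_Zmx : smooth_map (Zmx beta).
Proof.
pose L (z : 'rV[R]_(dim 'End(W))) : 'rV[R]_(dim 'M[R]_n) := v2r (mx_of beta (r2v z)).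
apply: (@smooth_to_open_space (aut_space W) _ _ _ (Zmx beta) (fun _ => L) aut_atlas).
  by move=> _; apply: smooth_on_linear; exact: v2r_mx_of_linear.
by move=> i x _; rewrite val_Zmx //= /L v2rK.
Qed.

Lemma smooth_ZmxV : smooth_map (ZmxV beta).
Proof.
pose L (z : 'rV[R]_(dim 'M[R]_n)) : 'rV[R]_(dim 'End(W)) := v2r (lfun_of beta (r2v z)).
apply: (@smooth_to_open_space (GL_space n) _ _ _ (ZmxV beta) (fun _ => L) (@GL_atlas n)).
  by move=> _; apply: smooth_on_linear; exact: v2r_lfun_of_linear.
by move=> i x _; rewrite val_ZmxV //= /L v2rK.
Qed.

End Matrices.

(** For X = [a, B] this is the velocity Ba, not B. *)
Definition GL_vec n (X : tangent (@GL_space R n)) : 'M[R]_n :=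
  @r2v R 'M[R]_n (vec X).

(** * The product rule for matrix multiplication *)

Section GLmul.
Variable n : nat.
Local Notation d := (dim 'M[R]_n).

Lemma rV_bilinear_continuous a b c (B : {bilinear 'rV[R]_a -> 'rV[R]_b -> 'rV[R]_c}) :
  continuous (fun p : 'rV[R]_a * 'rV[R]_b => B p.1 p.2).
Proof.
have -> : (fun p : 'rV[R]_a * 'rV[R]_b => B p.1 p.2) =
    fun p => \sum_i p.1 0 i *: B (delta_mx 0 i) p.2.
  apply/funext => p; rewrite {1}[p.1]row_sum_delta linear_sumlz.
  by apply: eq_bigr => i _; rewrite linearZl_LR.
have cD : continuous (fun x : 'rV[R]_c * 'rV[R]_c => x.1 + x.2).
  exact: add_continuous.
apply: (continuous_big cD) => i _ p; apply: cvgZ.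
  apply: (@continuous_comp _ _ _ fst (fun u : 'rV[R]_a => u 0 i)).
    exact: cvg_fst.
  exact: coord_continuous.
apply: (@continuous_comp _ _ _ snd (B (delta_mx 0 i))); first exact: cvg_snd.
apply: rV_linear_continuous => l u v; exact: linearPr.
Qed.

Lemma smooth_on_bilinear a b c m (B : {bilinear 'rV[R]_a -> 'rV[R]_b -> 'rV[R]_c})
    (U : set 'rV[R]_m) (f : 'rV[R]_m -> 'rV[R]_a) (g : 'rV[R]_m -> 'rV[R]_b) :
  open U -> smooth_on U f -> smooth_on U g -> smooth_on U (fun z => B (f z) (g z)).
Proof.
move=> oU sf sg k.
have -> : (fun z => B (f z) (g z)) =
    fun z => \sum_i f z 0 i *: (B (delta_mx 0 i) \o g) z.
  apply/funext => z; rewrite {1}[f z]row_sum_delta linear_sumlz.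
  by apply: eq_bigr => i _; rewrite linearZl_LR.
apply: Ck_on_sum => // i; apply: Ck_on_coord_scale (sf k) _ => //.
apply: (Ck_on_comp (W := setT) oU _ (sg k)) => //.
apply: Ck_on_linear => l u v; exact: linearPr.
Qed.

Definition rV_mul (u v : 'rV[R]_d) : 'rV[R]_d :=
  v2r (@r2v R 'M[R]_n u *m @r2v R 'M[R]_n v).

Fact rV_mul_bilinear : bilinear_for *:%R *:%R rV_mul.
Proof.
split=> [v l u w|u l v w].
  by rewrite /rV_mul linearP mulmxDl -scalemxAl linearP.
by rewrite /rV_mul linearP mulmxDr -scalemxAr linearP.
Qed.
HB.instance Definition _ :=
  bilinear_isBilinear.Build R _ _ _ _ _ rV_mul rV_mul_bilinear.

Definition GL_mul2 (p : prod_space (@GL_space R n) (@GL_space R n)) : GL_space n :=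
  GL_mul p.1 p.2.

Lemma smooth_GL_mul2 : smooth_map GL_mul2.
Proof.
pose B : {bilinear 'rV[R]_d -> 'rV[R]_d -> 'rV[R]_d} := rV_mul.
pose L (z : 'rV[R]_(d + d)) : 'rV[R]_d := B (lsubmx z) (rsubmx z).
apply: (@smooth_to_open_space (prod_space (GL_space n) (GL_space n)) _ _ _ GL_mul2
  (fun _ => L) (prod_atlas (@GL_atlas n) (@GL_atlas n))).
  move=> _; apply: smooth_on_bilinear; first exact: openT.
    exact/smooth_on_linear/lsubmx_linear.
  exact/smooth_on_linear/rsubmx_linear.
by move=> i [x y] _; rewrite /L /= row_mxKl row_mxKr /rV_mul !v2rK.
Qed.

Lemma tmap_GL_mul2 (X Y : tangent (@GL_space R n)) :
  tmap GL_mul2 (tangent_pair X Y) = @Tangent R (GL_space n)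
    (GL_mul (base X) (base Y))
    (v2r (val (base X) *m GL_vec Y + GL_vec X *m val (base Y))).
Proof.
case: X Y => [x v] [y w]; rewrite tmapE /=; congr Tangent.
set p := (x, y) : prod_space (@GL_space R n) (@GL_space R n).
pose B : {bilinear 'rV[R]_d -> 'rV[R]_d -> 'rV[R]_d} := rV_mul.
pose L (z : 'rV[R]_(d + d)) : 'rV[R]_d := B (lsubmx z) (rsubmx z).
have aP := prod_atlas (@GL_atlas n) (@GL_atlas n).
set q := chart (c := prod_space (@GL_space R n) (@GL_space R n)) (tt, tt) p.
(* Off the invertible matrices the inverse chart returns a default value, so the bilinear formula is
   only claimed near q. *)
have e : {near q, L =1 chart (c := @GL_space R n) tt \o GL_mul2 \o
    chartV (c := prod_space (@GL_space R n) (@GL_space R n)) (tt, tt)}.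
  have nq := @near_ldom R (prod_space (GL_space n) (GL_space n)) _ id (tt, tt) (tt, tt) p
    (smooth_atlas_id aP) (conj Logic.I Logic.I) (conj Logic.I Logic.I).
  apply: filterS nq => z /(ldomP aP) [ez _ _]; rewrite -{1}ez.
  by rewrite /L /= row_mxKl row_mxKr /rV_mul !v2rK.
have dl := rV_linear_differentiable q (@lsubmx_linear R d d).
have dr := rV_linear_differentiable q (@rsubmx_linear R d d).
have [dL EL] := diff_bilinear_comp (@rV_bilinear_continuous _ _ _ B) dl dr.
have [_ E] := near_eq_differentiable e dL.
apply: (etrans (congr1 (fun h => h (row_mx v w)) E)).
apply: (etrans (EL (row_mx v w))).
have Dl := congr1 (fun h => h (row_mx v w)) (rV_linear_diff q (@lsubmx_linear R d d)).
have Dr := congr1 (fun h => h (row_mx v w)) (rV_linear_diff q (@rsubmx_linear R d d)).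
apply: (etrans (f_equal2 (fun a b => B (lsubmx q) b + B a (rsubmx q)) Dl Dr)).
by rewrite /= !row_mxKl !row_mxKr /rV_mul !v2rK linearD.
Qed.

End GLmul.

(** For a velocity v at a, the bracket form has B = v a^-1, so the block Ba is v itself. This makes
    [J] linear in the coordinates (a, v). *)
Lemma val_J n (X : tangent (@GL_space R n)) :
  val (J X) = block_mx (val (base X)) 0 (GL_vec X) (val (base X)).
Proof.
case: X => a v; rewrite /= /GL_unbracket GL_Rmul_diff v2rK /=.
by rewrite mulmxKV //; exact: valP a.
Qed.

Lemma smooth_J n : smooth_map (M := tangent_space (@GL_space R n)) (N := GL_space (n + n)) (@J R n).
Proof.
have aT := tangent_atlas (@GL_atlas n).
pose L (z : 'rV[R]_(dim 'M[R]_n + dim 'M[R]_n)) : 'rV[R]_(dim 'M[R]_(n + n)) :=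
  v2r (block_mx (@r2v R 'M[R]_n (lsubmx z)) 0 (@r2v R 'M[R]_n (rsubmx z))
    (@r2v R 'M[R]_n (lsubmx z))).
apply: (@smooth_to_open_space (tangent_space (GL_space n)) _ _ _ (@J R n) (fun _ => L) aT).
  have bl l (A B C D : 'M[R]_n) : block_mx (l *: A + B) 0 (l *: C + D) (l *: A + B) =
      l *: block_mx A 0 C A + block_mx B 0 D B.
    by rewrite scale_block_mx add_block_mx scaler0 addr0.
  move=> _; apply: smooth_on_linear => l u v.
  by rewrite /L lsubmx_linear rsubmx_linear 2!linearP bl linearP.
move=> [] [a v] _; rewrite val_J /L /GL_vec [chart _ _]tchartE row_mxKl row_mxKr /=.
by rewrite mdiff_id ?v2rK //; exact: GL_atlas.
Qed.

End OpenSubspaces.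

(** * Uniform estimates *)

Section MatrixNorm.
Context {R : realType}.

Lemma mx_norm_le m n (A : 'M[R]_(m, n)) (K : R) :
  0 <= K -> (forall i j, `|A i j| <= K) -> `|A| <= K.
Proof.
move=> K0 AK; rewrite [leLHS]/Num.Def.normr /= mx_normrE.
by rewrite (bigmax_le _ K0) //= => i _; exact: AK.
Qed.

Lemma mx_coord_le m n (A : 'M[R]_(m, n)) i j : `|A i j| <= `|A|.
Proof.
rewrite [leRHS]/Num.Def.normr /= mx_normrE.
exact: (@le_bigmax _ _ _ 0 (fun ij : 'I_m * 'I_n => `|A ij.1 ij.2|) (i, j)).
Qed.

(** The norm is the largest absolute value of an entry; the inner dimension enters because each
    entry of the product is a sum of n terms. *)
Lemma mulmx_norm_le m n p (A : 'M[R]_(m, n)) (B : 'M[R]_(n, p)) :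
  `|A *m B| <= n%:R * `|A| * `|B|.
Proof.
apply: mx_norm_le => [|i j]; first by rewrite !mulr_ge0.
rewrite mxE; apply: le_trans (ler_norm_sum _ _ _) _.
apply: (@le_trans _ _ (\sum_(k < n) `|A| * `|B|)).
  by apply: ler_sum => k _; rewrite normrM ler_pM // mx_coord_le.
by rewrite sumr_const card_ord -[leLHS]mulr_natl mulrA.
Qed.

Lemma mx_norm1_le n : `|1%:M : 'M[R]_n| <= 1.
Proof.
apply: mx_norm_le => // i j; rewrite mxE.
by case: (_ == _); rewrite ?normr1 // normr0.
Qed.

(** [B j] is (1 + E)^j. As long as it is within 1 of the identity its norm is at most 2, so one more
    factor moves it by at most 2n|E|; the bound on N keeps the total displacement below 1. *)
Lemma pow_near_one n (B : nat -> 'M[R]_n) (E : 'M[R]_n) N :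
  B 0 = 1%:M -> (forall j, B j.+1 = (1%:M + E) *m B j) ->
  2 * n%:R * N%:R * `|E| <= 1 ->
  forall j, (j <= N)%N -> `|B j - 1%:M| <= 2 * n%:R * j%:R * `|E|.
Proof.
move=> B0 BS hN; elim=> [|j IH] jN; first by rewrite B0 subrr normr0 mulr0 mul0r.
have {}IH := IH (ltnW jN).
have B2 : `|B j| <= 2.
  rewrite -[B j](subrK 1%:M) (le_trans (ler_normD _ _)) // (_ : 2 = 1 + 1) //.
  rewrite lerD ?mx_norm1_le // (le_trans IH) // (le_trans _ hN) //.
  by rewrite ler_wpM2r // ler_wpM2l ?mulr_ge0 // ler_nat ltnW.
have -> : B j.+1 - 1%:M = (B j - 1%:M) + E *m B j by rewrite BS mulmxDl mul1mx addrAC.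
have -> : 2 * n%:R * j.+1%:R * `|E| = 2 * n%:R * j%:R * `|E| + n%:R * `|E| * 2.
  by rewrite -[j.+1%:R]natr1; ring.
apply: le_trans (ler_normD _ _) _; apply: lerD => //.
by apply: le_trans (mulmx_norm_le _ _) _; rewrite ler_wpM2l // mulr_ge0.
Qed.

End MatrixNorm.

Section MeanValue.
Context {R : realType}.

(** The mean value theorem is applied to each coordinate along the segment. The intermediate point
    depends on the coordinate, which is harmless for the maximum norm. *)
Lemma mean_value_le a b (f : 'rV[R]_a -> 'rV[R]_b) x h (K : R) : 0 <= K ->
  (forall t : R, 0 <= t <= 1 -> differentiable f (x + t *: h)) ->
  (forall t : R, 0 <= t <= 1 -> `|'d f (x + t *: h) h| <= K) ->
  `|f (x + h) - f x| <= K.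
Proof.
move=> K0 df fK; apply: mx_norm_le => // i j; rewrite ord1 {i}.
pose line (t : R) := x + t *: h.
have dline (t : R) : differentiable line t /\ 'd line t 1 = h.
  have dc : differentiable (cst x : R -> 'rV[R]_a) t by exact: differentiable_cst.
  have [ds Es] : is_diff t ( *:%R^~ h) ( *:%R^~ h) := is_diff_scalel t h.
  have -> : line = cst x + ( *:%R^~ h) by [].
  split; first exact: (differentiableD dc ds).
  apply: (etrans (diffDE (1 : R^o) dc ds)).
  have Ec := congr1 (fun g => g 1) (diff_cst x t).
  apply: (etrans (f_equal2 +%R Ec (congr1 (fun g => g 1) Es))).
  by rewrite add0r scale1r.
pose phi (t : R) : R := f (line t) 0 j.
have dphi (t : R) : 0 <= t <= 1 -> is_derive t 1 phi ('d f (line t) h 0 j).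
  move=> t01; have [dl El] := dline t; have dft := df t t01.
  have clin : linear (fun u : 'rV[R]_b => u 0 j : R^o).
    by move=> l u v; rewrite !mxE.
  have dfl := differentiable_comp dl dft.
  have dc := rV_linear_differentiable (f (line t)) clin.
  have E := diff_linear_comp (1 : R^o) clin dfl.
  have d : differentiable (phi : R -> R^o) t := differentiable_comp dfl dc.
  apply: DeriveDef; first exact: diff_derivable.
  rewrite (deriveE (1 : R^o) d); apply: (etrans E).
  have E2 := congr1 (fun h => h 1) (diff_comp dl dft).
  by apply: (congr1 (fun u : 'rV[R]_b => u 0 j) (etrans E2 _)); rewrite /= El.
have [||t t01] := @MVT_segment R phi (fun t => 'd f (line t) h 0 j) 0 1 ler01.
- move=> t; rewrite in_itv /= => /andP[t0 t1]; apply: dphi.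
  by rewrite !ltW.
- apply: continuous_in_subspaceT => t; rewrite inE /= in_itv /= => t01.
  have [d _] := dphi t t01.
  by apply: differentiable_continuous; apply/derivable1_diffP.
rewrite subr0 mulr1 /phi /line scale1r scale0r addr0 => e.
have -> : (f (x + h) - f x) 0 j = 'd f (x + t *: h) h 0 j.
  by rewrite mxE [X in _ + X]mxE e.
rewrite in_itv /= in t01.
exact: le_trans (mx_coord_le _ _ _) (fK t t01).
Qed.

End MeanValue.

Section NearTranslation.
Context {R : realType}.

Lemma norm_row_mx_lt a b (u : 'rV[R]_a) (v : 'rV[R]_b) (r : R) :
  `|u| < r -> `|v| < r -> `|row_mx u v| < r.
Proof.
move=> ur vr; apply: (@le_lt_trans _ _ (Num.max `|u| `|v|)); last by rewrite gt_max ur.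
apply: mx_norm_le => [|k j]; first by rewrite le_max normr_ge0.
rewrite mxE le_max; case: (fintype.split j) => l; first by rewrite mx_coord_le.
by rewrite mx_coord_le orbT.
Qed.

(* Both partial differentials of [F] at (c, c) are the identity, by continuity
   the first one stays close to it; then the mean value inequality applies. *)
Lemma near_translation m (U2 : set 'rV[R]_(m + m))
    (F : 'rV[R]_(m + m) -> 'rV[R]_m) (c : 'rV[R]_m) :
  open U2 -> smooth_on U2 F -> U2 (row_mx c c) ->
  (forall h, 'd F (row_mx c c) (row_mx h 0) = h) ->
  (forall y, U2 (row_mx c y) -> F (row_mx c y) = y) ->
  exists2 r : R, 0 < r &
  forall x y : 'rV[R]_m, `|x - c| < r -> `|y - c| < r ->
    U2 (row_mx x y) /\ `|F (row_mx x y) - y - (x - c)| <= 2^-1 * `|x - c|.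
Proof.
move=> oU sF Uq dFl Fr.
(* Each of the m basis directions contributes at most [eps] times |h|, in total at most half of |h|;
   the successor keeps [eps] positive when m = 0. *)
pose eps : R := (2 * m.+1%:R)^-1.
have eps0 : 0 < eps by rewrite invr_gt0 mulr_gt0.
pose E l : 'rV[R]_(m + m) := row_mx (delta_mx 0 l) 0.
have nl l : \forall q \near row_mx c c, `|'D_(E l) F (row_mx c c) - 'D_(E l) F q| < eps.
  have [_ sD] := sF 1; have cD : {for row_mx c c, continuous (fun q => 'D_(E l) F q)}.
    exact: sD.
  by move/cvgrPdist_lt : cD => /(_ eps eps0).
have nU := open_near oU Uq.
have nA : \forall q \near row_mx c c, forall l, `|'D_(E l) F (row_mx c c) - 'D_(E l) F q| < eps.
  exact: (filter_forall (nbhs_filter (row_mx c c : 'rV[R]_(m + m))) nl).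
have nUA : nbhs (row_mx c c) [set q | U2 q /\
    forall l, `|'D_(E l) F (row_mx c c) - 'D_(E l) F q| < eps].
  exact: (filterI nU nA).
have /nbhs_ballP [r /= r0 rA] := nUA.
exists r => // x y xr yr.
have bq p : `|p - c| < r -> ball (row_mx c c) r (row_mx p y).
  move=> pr; rewrite -ball_normE /= opp_row_mx add_row_mx.
  by apply: norm_row_mx_lt; rewrite distrC.
have dF p : `|p - c| < r -> differentiable F (row_mx p y).
  by move=> /bq /rA [Up _]; exact: smooth_on_differentiable sF Up.
have dq : differentiable F (row_mx c c) by exact: smooth_on_differentiable sF Uq.
split; first by have [] := rA _ (bq _ xr).
have expand q h : differentiable F q ->
    'd F q (row_mx h 0) = \sum_l h 0 l *: 'D_(E l) F q.
  move=> dFq; have -> : row_mx h 0 = \sum_l h 0 l *: E l :> 'rV[R]_(m + m).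
    rewrite {1}[h]row_sum_delta.
    elim/big_rec2: _ => [|l u v _ <-]; first by rewrite row_mx0.
    by rewrite scale_row_mx add_row_mx scaler0 add0r.
  rewrite linear_sum; apply: eq_bigr => l _; rewrite linearZ.
  by rewrite -deriveE.
set h := x - c.
have bound p : `|p - c| < r -> `|'d F (row_mx p y) (row_mx h 0) - h| <= 2^-1 * `|h|.
  move=> pr; have [_ Ap] := rA _ (bq _ pr).
  have E1 := expand _ h (dF _ pr).
  have E2 := etrans (esym (dFl h)) (expand _ h dq).
  have E12 : 'd F (row_mx p y) (row_mx h 0) - h =
      \sum_l h 0 l *: ('D_(E l) F (row_mx p y) - 'D_(E l) F (row_mx c c)).
    apply: (etrans (f_equal2 (fun u v => u - v) E1 E2)); rewrite -sumrB.
    by apply: eq_bigr => l _; rewrite scalerBr.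
  rewrite E12; apply: le_trans (ler_norm_sum _ _ _) _.
  apply: (@le_trans _ _ (\sum_(l < m) `|h| * eps)).
    apply: ler_sum => l _; rewrite normrZ ler_pM ?mx_coord_le //.
    by rewrite distrC ltW.
  rewrite sumr_const card_ord -[leLHS]mulr_natl mulrCA [leRHS]mulrC.
  rewrite ler_wpM2l // /eps invfM mulrCA ler_piMr ?invr_ge0 //.
  by rewrite ler_pdivrMr // mul1r ler_nat.
pose rowy (p : 'rV[R]_m) : 'rV[R]_(m + m) := row_mx p y.
(* f(p) = F(p, y) - p. Since F(c, y) = y, its increment from c to x is exactly the quantity to
   estimate. *)
pose f : 'rV[R]_m -> 'rV[R]_m := (F \o rowy) + -%R.
have drow p : differentiable rowy p /\ forall v, 'd rowy p v = row_mx v 0.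
  have idlin : linear (id : 'rV[R]_m -> 'rV[R]_m) by [].
  have [d Ed] := diff_row_mx (rV_linear_differentiable p idlin) (differentiable_cst y p).
  split=> // v; apply: (etrans (Ed v)).
  have E1 := congr1 (fun g => g v) (rV_linear_diff p idlin).
  have E2 := congr1 (fun g => g v) (diff_cst y p).
  exact: (f_equal2 (@row_mx R 1 m m) E1 E2).
have opplin : linear (-%R : 'rV[R]_m -> 'rV[R]_m).
  by move=> l u v; rewrite opprD scalerN.
have df p : `|p - c| < r -> differentiable f p /\
    'd f p h = 'd F (row_mx p y) (row_mx h 0) - h.
  move=> pr; have [dr Er] := drow p; have dc := differentiable_comp dr (dF p pr).
  have dN := rV_linear_differentiable p opplin.
  split; first exact: differentiableD.
  apply: (etrans (diffDE h dc dN)).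
  have E1 := congr1 (fun g => g h) (diff_comp dr (dF p pr)).
  have E2 := congr1 (fun g => g h) (rV_linear_diff p opplin).
  apply: (etrans (f_equal2 +%R E1 E2)) => /=.
  by rewrite Er.
have seg (t : R) : 0 <= t <= 1 -> `|c + t *: h - c| < r.
  move=> /andP[t0 t1]; rewrite addrAC subrr add0r normrZ ger0_norm //.
  by apply: le_lt_trans xr; rewrite ler_piMl.
have K0 : 0 <= 2^-1 * `|h| by rewrite mulr_ge0 // invr_ge0.
have := @mean_value_le R m m f c h (2^-1 * `|h|) K0.
have -> : f (c + h) - f c = F (row_mx x y) - y - h.
  have Fc : F (row_mx c y) = y.
    have cr : `|c - c| < r by rewrite subrr normr0.
    by have [Uy _] := rA _ (bq _ cr); exact: Fr.
  have fE p : f p = F (row_mx p y) - p by [].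
  have xE : c + h = x by rewrite /h addrC subrK.
  rewrite !fE Fc xE /h.
  by rewrite !opprB addrA addrAC -!addrA; congr (_ + _); rewrite addrC addrA.
apply=> t t01; first by have [] := df _ (seg t t01).
by have [_ ->] := df _ (seg t t01); exact: bound (seg t t01).
Qed.

End NearTranslation.

(** * Multiplication in a chart around the identity *)

Section NearOne.
Context {R : realType} (G : lieData R).
Hypothesis Glie : lie_group G.

Local Notation e := (lie_one G).
Local Notation i := (chart_at e).
Local Notation c := (chart i e).
Local Notation m := (mdim G).
Local Notation U2 := (ldom (@lie_mul2 R G) (i, i) i : set 'rV[R]_(m + m)).
Local Notation F := (chart i \o @lie_mul2 R G \o chartV (c := prod_space G G) (i, i)
  : 'rV[R]_(m + m) -> 'rV[R]_m).

Lemma lie_mulV (x : G) : lie_mul x (lie_inv x) = e.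
Proof.
have [_ [mA m1 mV] _ _] := Glie.
by rewrite -[LHS]m1 -(mV (lie_inv x)) -mA (mA (lie_inv x)) mV m1.
Qed.

Lemma lie_mulr1 (x : G) : lie_mul x e = x.
Proof.
by have [_ [mA m1 mV] _ _] := Glie; rewrite -(mV x) mA lie_mulV m1.
Qed.

Lemma lie_mul_cancel (x y : G) : lie_mul (lie_inv x) y = e -> x = y.
Proof.
have [_ [mA m1 mV] _ _] := Glie.
by move=> xy; rewrite -[LHS]lie_mulr1 -xy mA lie_mulV m1.
Qed.

(** Obtained by differentiating x e = x, since (h, 0) is the image of h under the differential of x
    -> (x, e). *)
Lemma lie_mul_diff_l h : 'd F (row_mx c c) (row_mx h 0) = h.
Proof.
have aG := lie_atlas Glie; have [_ _ sm _] := Glie.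
have ie : dom i e by exact: chart_atP.
have [_ [_ m1 _] _ _] := Glie.
have sI := smooth_atlas_id aG; have sc := smooth_map_cst e aG aG.
have sp := smooth_map_pair aG sI sc.
have ke : dom i (lie_mul2 (e, e) : G) by rewrite /lie_mul2 m1.
have := @mdiff_comp R G (prod_space G G) G (fun x => (x, e)) (@lie_mul2 R G)
  i (i, i) i e h aG (prod_atlas aG aG) sp sm ie (conj ie ie) ke.
have Ep := @mdiff_pair R G G G id (fun=> e) i i i e h sI sc ie ie ie.
rewrite mdiff_id // mdiff_cst in Ep.
have -> : @lie_mul2 R G \o (fun x => (x, e)) = id.
  by apply/funext => x; exact: lie_mulr1.
rewrite mdiff_id // => E0; apply: etrans E0.
exact: (congr1 (fun u => 'd F (row_mx c c) u) (esym Ep)).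
Qed.

Lemma lie_mul_near_one : exists2 r : R, 0 < r &
  forall x y : 'rV[R]_m, `|x - c| < r -> `|y - c| < r ->
    U2 (row_mx x y) /\ `|F (row_mx x y) - y - (x - c)| <= 2^-1 * `|x - c|.
Proof.
have aG := lie_atlas Glie; have [_ [_ m1 _] sm _] := Glie.
have ie : dom i e by exact: chart_atP.
have ke : dom i (lie_mul2 (e, e) : G) by rewrite /lie_mul2 m1.
have aGG := prod_atlas aG aG.
have [oU sF] := sm (i, i) i.
apply: (near_translation oU sF) => [|h|y Uy].
- exact: (@ldom_chart R (prod_space G G) G (@lie_mul2 R G) (i, i) i (e, e)).
- exact: lie_mul_diff_l.
- have [+ _ _] := ldomP aGG Uy.
  rewrite /= row_mxKl row_mxKr (chartK aG ie) => /eq_row_mx [_ ey].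
  by rewrite /lie_mul2 /= m1.
Qed.

End NearOne.

(** * Injective homomorphisms are immersions *)

Section Immersion.
Context {R : realType} (G : lieData R) (n : nat) (rho : G -> @GL_space R n).
Hypothesis Glie : lie_group G.
Hypothesis rho_smooth : smooth_map rho.
Hypothesis rhoM : forall x y, rho (lie_mul x y) = GL_mul (rho x) (rho y).
Hypothesis rho_inj : injective rho.

Local Notation e := (lie_one G).
Local Notation i := (chart_at e).
Local Notation c := (chart i e).
Local Notation m := (mdim G).
Local Notation U2 := (ldom (@lie_mul2 R G) (i, i) i : set 'rV[R]_(m + m)).
Local Notation F := (chart i \o @lie_mul2 R G \o chartV (c := prod_space G G) (i, i)
  : 'rV[R]_(m + m) -> 'rV[R]_m).

(** Each multiplication by g adds w/N with an error of at most |w|/(2N). The accumulated bound keeps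
    every power within 2|w| < r of c, so that the estimate can be applied again. *)
Lemma iter_mul_chart (r : R) (w : 'rV[R]_m) (N : nat) (g : G) :
  (forall x y : 'rV[R]_m, `|x - c| < r -> `|y - c| < r ->
    U2 (row_mx x y) /\ `|F (row_mx x y) - y - (x - c)| <= 2^-1 * `|x - c|) ->
  (0 < N)%N -> 2 * `|w| < r -> g = chartV i (c + N%:R^-1 *: w) ->
  forall j, (j <= N)%N -> dom i (iter j (lie_mul g) e) /\
    `|chart i (iter j (lie_mul g) e) - c - (j%:R / N%:R) *: w|
      <= 2^-1 * (j%:R / N%:R) * `|w|.
Proof.
move=> near1 N0 wr gE; have aG := lie_atlas Glie.
have ie : dom i e by exact: chart_atP.
have N0' : 0 < N%:R :> R by rewrite ltr0n.
elim=> [_|j IH jN]; first by rewrite mul0r scale0r subrr subr0 normr0 mulr0 mul0r.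
have [id_j IHj] := IH (ltnW jN); rewrite iterS.
set y := iter j (lie_mul g) e in id_j IHj *.
have q01 : 0 <= j%:R / N%:R :> R by rewrite divr_ge0.
have q1 : j%:R / N%:R <= 1 :> R by rewrite ler_pdivrMr // mul1r ler_nat ltnW.
have w0 := normr_ge0 w.
have yr : `|chart i y - c| < r.
  apply: le_lt_trans wr.
  rewrite -[chart i y - c](subrK ((j%:R / N%:R) *: w)).
  apply: le_trans (ler_normD _ _) _; rewrite normrZ ger0_norm //.
  by nra.
have Nw : `|c + N%:R^-1 *: w - c| = N%:R^-1 * `|w|.
  by rewrite addrAC subrr add0r normrZ ger0_norm // invr_ge0 ltW.
have xr : `|c + N%:R^-1 *: w - c| < r.
  rewrite Nw; apply: le_lt_trans wr.
  have : N%:R^-1 <= 1 :> R by rewrite invf_le1 // ler1n.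
  by nra.
have [Uxy] := near1 _ _ xr yr; rewrite Nw.
have [_ _ ixy] := ldomP (prod_atlas aG aG) Uxy.
rewrite /= row_mxKl row_mxKr (chartK aG id_j) -gE in ixy.
have -> : F (row_mx (c + N%:R^-1 *: w) (chart i y)) = chart i (lie_mul g y).
  by rewrite /= row_mxKl row_mxKr (chartK aG id_j) -gE.
move=> est; split=> //.
have -> : chart i (lie_mul g y) - c - (j.+1%:R / N%:R) *: w =
   (chart i (lie_mul g y) - chart i y - (c + N%:R^-1 *: w - c)) +
   (chart i y - c - (j%:R / N%:R) *: w).
  rewrite -[j.+1%:R]natr1 mulrDl mul1r scalerDl.
  by rewrite opprD [c + _ - c]addrAC subrr add0r; apply/rowP => k; rewrite !mxE; ring.
apply: le_trans (ler_normD _ _) _.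
rewrite -[j.+1%:R]natr1 mulrDl mul1r mulrDr mulrDl [leRHS]addrC.
by apply: lerD => //; rewrite -mulrA.
Qed.

Lemma GL_hom1 : val (rho e) = 1%:M.
Proof.
have [_ [_ m1 _] _ _] := Glie.
have E : val (rho e) *m val (rho e) = val (rho e).
  by rewrite -[RHS](congr1 (fun x => val (rho x)) (m1 e)) rhoM.
have u : val (rho e) \in unitmx := valP (rho e).
by rewrite -[LHS](mulmxK u) E mulmxV.
Qed.

Lemma GL_hom_iter (g : G) j : val (rho (iter j.+1 (lie_mul g) e)) =
  val (rho g) *m val (rho (iter j (lie_mul g) e)).
Proof. by rewrite iterS rhoM. Qed.

Local Notation f := (fun x => val (rho (chartV i x)) : 'M[R]_n).

Lemma GL_hom_chart_differentiable : differentiable f c /\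
  forall w, 'd f c w = @r2v R 'M[R]_n (mdiff rho i tt e w).
Proof.
have aG := lie_atlas Glie; have ie : dom i e by exact: chart_atP.
have d := @lrep_differentiable R G (GL_space n) rho i tt e rho_smooth ie Logic.I.
have lin : linear (@r2v R 'M[R]_n) by move=> l u v; rewrite linearP.
have fE : f = @r2v R 'M[R]_n \o (chart (c := GL_space n) tt \o rho \o chartV i).
  by apply/funext => x; rewrite /= v2rK.
rewrite fE; split=> [|w]; last exact: (diff_linear_comp w lin d).
exact: (differentiable_comp d (rV_linear_differentiable _ lin)).
Qed.

(** The quantity is the norm of the difference quotient along w with increment 1/N, which tends to
    the vanishing derivative. *)
Lemma GL_hom_small_step w (eps : R) : mdiff rho i tt e w = 0 -> 0 < eps ->
  exists2 N : nat, (0 < N)%N & N%:R * `|f (c + N%:R^-1 *: w) - f c| < eps.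
Proof.
move=> dw eps0; have [df Ef] := GL_hom_chart_differentiable.
have cvD : h^-1 *: (f (h *: w + c) - f c) @[h --> 0^'] --> 'd f c w.
  by rewrite -(deriveE w df); exact: (diff_derivable df).
move/cvgrPdist_lt : cvD => /(_ _ eps0) [d /= d0 dP].
have [N _ Nd] := near_infty_natSinv_lt (PosNum d0).
have {}Nd := Nd N (leqnn N); rewrite /= in Nd.
have N0 : N.+1%:R^-1 != 0 :> R by rewrite invr_eq0 pnatr_eq0.
have := dP N.+1%:R^-1; rewrite /= sub0r normrN ger0_norm ?invr_ge0 //.
move=> /(_ Nd N0) small; exists N.+1 => //.
move: small; rewrite Ef dw linear0 sub0r normrN normrZ invrK ger0_norm //.
by rewrite [_ *: _ + _]addrC.
Qed.

Lemma GL_hom_mdiff_inj w : mdiff rho i tt e w = 0 -> w = 0.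
Proof.
have aG := lie_atlas Glie; have ie : dom i e by exact: chart_atP.
move=> dw0; apply/eqP/negPn/negP => w0.
have [r r0 near1] := lie_mul_near_one Glie.
(* Rescaled to norm r/4, so that 2|v| < r and the annulus [K] stays where the estimate on products
   holds. *)
pose v := (r / 4 / `|w|) *: w.
have nw : 0 < `|w| by rewrite normr_gt0.
have vE : `|v| = r / 4.
  by rewrite normrZ ger0_norm ?divr_ge0 // ?divr_ge0 // ?ltW // divfK ?gt_eqF.
have dv0 : mdiff rho i tt e v = 0.
  have E : mdiff rho i tt e v = (r / 4 / `|w|) *: mdiff rho i tt e w.
    exact: linearZ.
  by rewrite E dw0 scaler0.
have vr : 2 * `|v| < r by rewrite vE; lra.
(* The N-th power of g will lie between |v|/2 and 3|v|/2 from c, hence in this annulus, which omits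
   c. *)
pose K : set 'rV[R]_m := (fun x => `|x - c|) @^-1` `[`|v| / 2, 2 * `|v|]%classic.
have cn : continuous (fun x : 'rV[R]_m => `|x - c|).
  move=> x; apply: (@continuous_comp 'rV[R]_m 'rV[R]_m R (fun x => x - c) (fun u => `|u|)).
    by apply: continuousB; [exact: cvg_id | exact: cst_continuous].
  exact: norm_continuous.
have cK : compact K.
  apply: bounded_closed_compact.
    exists (2 * `|v| + `|c|); split; first exact: num_real.
    move=> M hM x; rewrite /K /= in_itv /= => /andP[_ xv].
    rewrite -[x](subrK c); apply: le_trans (ler_normD _ _) _.
    by rewrite ltW // (le_lt_trans _ hM) // lerD.
  apply: closed_comp; first by move=> x _; exact: cn.
  exact: itv_closed.
have Kr x : K x -> `|x - c| < r.
  by rewrite /K /= in_itv /= => /andP[_ xv]; exact: le_lt_trans xv vr.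
have cr : `|c - c| < r by rewrite subrr normr0.
(* Applied to the pair (x, c), the estimate also says that this pair is in the image of the product
   chart; hence x is the coordinate of a point. *)
have Kdom x : K x -> chart i (chartV i x) = x /\ dom i (chartV i x).
  move=> /Kr xr; have [Ux _] := near1 _ _ xr cr.
  have [] := ldomP (prod_atlas aG aG) Ux; rewrite /= row_mxKl row_mxKr.
  by move=> /eq_row_mx [-> _] [].
pose phi x := `|f x - 1%:M|.
have cphi : {in K, continuous phi}.
  move=> x; rewrite inE => /Kdom [ex ix].
  have d := @lrep_differentiable R G (GL_space n) rho i tt (chartV i x) rho_smooth ix Logic.I.
  have lin : linear (@r2v R 'M[R]_n) by move=> l u u'; rewrite linearP.
  have fE : f = @r2v R 'M[R]_n \o (chart (c := GL_space n) tt \o rho \o chartV i).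
    by apply/funext => y; rewrite /= v2rK.
  have cf : {for x, continuous f}.
    rewrite fE; apply: differentiable_continuous; rewrite ex in d.
    exact: (differentiable_comp d (rV_linear_differentiable _ lin)).
  apply: (@continuous_comp 'rV[R]_m 'M[R]_n R (fun x => f x - 1%:M) (fun u => `|u|)).
    by apply: continuousB; [exact: cf | exact: cst_continuous].
  exact: norm_continuous.
have K0 : K !=set0.
  by exists (c + v); rewrite /K /= addrAC subrr add0r in_itv /=; apply/andP; split; lra.
have [x0 x0K x0min] := EVT_min_rV K0 cK (continuous_in_subspaceT cphi).
rewrite inE in x0K.
have phi0 : 0 < phi x0.
  rewrite normr_gt0 subr_eq0; apply/eqP => fx0.
  have [ex0 ix0] := Kdom _ x0K.
  have E : chartV i x0 = e by apply: rho_inj; apply: val_inj; rewrite GL_hom1 -fx0.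
  move: x0K; rewrite /K /= -ex0 E subrr normr0 in_itv /= vE; lra.
(* With N|E| < eps, the first bound gives 2nN|E| < phi x0, the contradiction sought, and the second
   gives 2nN|E| <= 1, as [pow_near_one] requires. Adding 1 keeps the denominator positive when n =
   0. *)
pose eps := Num.min (phi x0 / (2 * n%:R + 1)) (2 * n%:R + 1)^-1.
have n1 : 0 < 2 * n%:R + 1 :> R by rewrite ltr_wpDl // mulr_ge0.
have eps0 : 0 < eps by rewrite lt_min divr_gt0 // invr_gt0.
have [N N0 step] := GL_hom_small_step dv0 eps0.
have fc : f c = 1%:M by rewrite (chartK aG ie) GL_hom1.
set x := c + N%:R^-1 *: v in step.
pose g := chartV i x.
pose E := f x - 1%:M.
rewrite fc -/E in step.
have [itN estN] := iter_mul_chart near1 N0 vr (erefl g) (leqnn N).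
rewrite divff ?pnatr_eq0 -?lt0n // scale1r mulr1 in estN.
set z := iter N (lie_mul g) e in itN estN.
have Kz : K (chart i z).
  rewrite /K /= in_itv /=; apply/andP; split.
    have := ler_normB (chart i z - c) (chart i z - c - v).
    rewrite opprB addrCA subrr addr0 => h; lra.
  rewrite -[chart i z - c](subrK v); apply: le_trans (ler_normD _ _) _.
  by have := normr_ge0 v; lra.
have := x0min (chart i z); rewrite inE => /(_ Kz); rewrite {2}/phi (chartK aG itN).
have hN : 2 * n%:R * N%:R * `|E| <= 1.
  have : N%:R * `|E| < (2 * n%:R + 1)^-1 by apply: (lt_le_trans step); rewrite ge_min lexx orbT.
  rewrite -[(_ + 1)^-1]mul1r ltr_pdivlMr // => h.
  have : 0 <= N%:R * `|E| by rewrite mulr_ge0.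
  by nra.
have := @pow_near_one R n (fun j => val (rho (iter j (lie_mul g) e))) E N GL_hom1 _ hN N (leqnn N).
have -> : 1%:M + E = val (rho g) by rewrite /E addrC subrK.
move=> /(_ (GL_hom_iter g)) zE phiz.
have := le_trans phiz zE.
have : N%:R * `|E| < phi x0 / (2 * n%:R + 1) by apply: (lt_le_trans step); rewrite ge_min lexx.
rewrite ltr_pdivlMr // => h.
have : 0 <= N%:R * `|E| by rewrite mulr_ge0.
by move=> h0; nra.
Qed.

End Immersion.

(** * The prolongation *)

Section Prolongation.
Context {R : realType} (G : lieData R) (V : vectType R) (n : nat).
Context (alpha : n.-tuple V) (Phi : G -> aut_lie V).
Hypothesis alpha_basis : basis_of fullv alpha.
Hypothesis Phi_rep : representation Phi.

Let matrix_rep : G -> GL_space n := Zmx alpha \o Phi.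

Lemma smooth_matrix_rep : smooth_map matrix_rep.
Proof.
have [Glie _ sP] := Phi_rep.
exact: (smooth_map_comp (lie_atlas Glie) (aut_atlas alpha_basis) sP
  (smooth_Zmx alpha_basis)).
Qed.

Lemma matrix_rep_mul x y : matrix_rep (lie_mul x y) = GL_mul (matrix_rep x) (matrix_rep y).
Proof.
have [_ PM _] := Phi_rep; apply: val_inj.
by rewrite /matrix_rep /= PM !val_Zmx //= mx_of_comp.
Qed.

(** This is T applied to rho(xy) = rho(x) rho(y), read as an equality of two maps on G x G. *)
Lemma tmap_matrix_rep_mul (X Y : tangent_lie G) :
  tmap matrix_rep (lie_mul X Y) = tmap (@GL_mul2 R n) (tangent_pair (tmap matrix_rep X) (tmap matrix_rep Y)).
Proof.
have [Glie _ _] := Phi_rep; have aG := lie_atlas Glie; have [_ _ sm _] := Glie.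
have aGG := prod_atlas aG aG; have aL := @GL_atlas R n; have aLL := prod_atlas aL aL.
have sr := smooth_matrix_rep; have s1 := smooth_map_fst aG aG; have s2 := smooth_map_snd aG aG.
pose r1 (p : prod_space G G) : GL_space n := matrix_rep p.1.
pose r2 (p : prod_space G G) : GL_space n := matrix_rep p.2.
have sr1 : smooth_map r1 := smooth_map_comp aGG aG s1 sr.
have sr2 : smooth_map r2 := smooth_map_comp aGG aG s2 sr.
set W := tangent_pair X Y.
have e1 : tmap r1 W = tmap matrix_rep X.
  apply: (etrans (esym (tmap_comp W aGG aG aL s1 sr))).
  by congr (tmap matrix_rep _); exact: tmap_fst.
have e2 : tmap r2 W = tmap matrix_rep Y.
  apply: (etrans (esym (tmap_comp W aGG aG aL s2 sr))).
  by congr (tmap matrix_rep _); exact: tmap_snd.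
rewrite -e1 -e2 (tmap_pair W aGG aL aL sr1 sr2).
have sp := smooth_map_pair aGG sr1 sr2.
apply: etrans (esym (tmap_comp W aGG aLL aL sp (@smooth_GL_mul2 R n))).
apply: (etrans (tmap_comp W aGG aG aL sm sr)).
by congr (tmap _ W); apply/funext => p; exact: matrix_rep_mul.
Qed.

Lemma val_prolongation (X : tangent_lie G) :
  val (prolongation alpha Phi X) = lfun_of (TV_basis alpha)
    (block_mx (val (matrix_rep (base X))) 0 (GL_vec (tmap matrix_rep X)) (val (matrix_rep (base X)))).
Proof.
have [Glie _ sP] := Phi_rep; have aG := lie_atlas Glie.
rewrite [LHS]val_ZmxV; last exact: TV_basis_basis.
congr lfun_of; rewrite val_J.
by rewrite (tmap_comp X aG (aut_atlas alpha_basis) (@GL_atlas R n) sP (smooth_Zmx alpha_basis)).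
Qed.

Lemma prolongation_mul (X Y : tangent_lie G) :
  prolongation alpha Phi (lie_mul X Y) =
  lie_mul (prolongation alpha Phi X) (prolongation alpha Phi Y).
Proof.
have E := val_prolongation.
have ev := etrans (congr1 (@GL_vec R n) (etrans (tmap_matrix_rep_mul X Y)
  (tmap_GL_mul2 (tmap matrix_rep X) (tmap matrix_rep Y)))) (v2rK _).
have eb : val (matrix_rep (base (lie_mul X Y))) = val (matrix_rep (base X)) *m val (matrix_rep (base Y)).
  exact: (congr1 val (matrix_rep_mul (base X) (base Y))).
apply: val_inj; apply: (etrans (E (lie_mul X Y))); symmetry.
apply: (etrans (f_equal2 (fun f g => (f \o g)%VF) (E X) (E Y))).
rewrite lfun_of_comp; last exact: TV_basis_basis.
apply: congr1; rewrite ev eb mulmx_block.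
by rewrite !mul0mx !mulmx0 !addr0 add0r addrC.
Qed.

Lemma prolongation_representation : representation (prolongation alpha Phi).
Proof.
have [Glie _ sP] := Phi_rep; have aG := lie_atlas Glie; have aT := tangent_atlas aG.
have aL := @GL_atlas R n; have aA := aut_atlas alpha_basis.
split; [exact: tangent_lie_group | exact: prolongation_mul |].
have s1 := smooth_tmap aG aA sP.
have s2 := smooth_tmap aA aL (smooth_Zmx alpha_basis).
have s12 := smooth_map_comp aT (tangent_atlas aA) s1 s2.
have s123 := smooth_map_comp aT (tangent_atlas aL) s12 (@smooth_J R n).
exact: (smooth_map_comp aT (@GL_atlas R (n + n)) s123 (smooth_ZmxV (TV_basis_basis alpha_basis))).
Qed.

Lemma matrix_rep_inj : injective Phi -> injective matrix_rep.
Proof. exact: inj_comp (can_inj (ZmxK alpha_basis)). Qed.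

Lemma prolongation_eq (X Y : tangent_lie G) :
  prolongation alpha Phi X = prolongation alpha Phi Y ->
  matrix_rep (base X) = matrix_rep (base Y) /\ vec (tmap matrix_rep X) = vec (tmap matrix_rep Y).
Proof.
move=> XY; have E := val_prolongation.
have := etrans (esym (E X)) (etrans (congr1 val XY) (E Y)).
move/(can_inj (lfun_ofK (TV_basis_basis alpha_basis))) => /eq_block_mx [e1 _ e2 _].
by split; [exact: val_inj | exact: r2v_inj e2].
Qed.

(** The diagonal block forces the base point to be the identity of G; the lower left block then says
    that the differential at this point kills the vector. *)
Lemma prolongation_kernel (X : tangent_lie G) : injective Phi ->
  prolongation alpha Phi X = prolongation alpha Phi (lie_one (tangent_lie G)) ->
  X = lie_one (tangent_lie G).
Proof.
have [Glie _ _] := Phi_rep; move=> /matrix_rep_inj rI /prolongation_eq [].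
case: X => x v /= /rI -> E; congr Tangent.
apply: (GL_hom_mdiff_inj Glie smooth_matrix_rep matrix_rep_mul rI).
by apply: (etrans E); exact: linear0.
Qed.

Lemma prolongation_inj : injective Phi -> injective (prolongation alpha Phi).
Proof.
move=> PI X Y XY; have [Glie _ _] := Phi_rep; have Tlie := tangent_lie_group Glie.
have [_ [_ _ mV] _ _] := Tlie.
apply: (@lie_mul_cancel R (tangent_lie G) Tlie X Y).
apply: (prolongation_kernel PI).
have M := prolongation_mul.
apply: (etrans (M (lie_inv X) Y)).
apply: (etrans (congr1 (lie_mul (prolongation alpha Phi (lie_inv X))) (esym XY))).
apply: (etrans (esym (M (lie_inv X) X))).
exact: (congr1 (prolongation alpha Phi) (mV X)).
Qed.

End Prolongation.

Theorem proposition3p4 (R : realType) (n : nat) (G : lieData R)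
    (V : vectType R) (alpha : n.-tuple V) (Phi : G -> aut_lie V)
    (dimV : \dim {:V} = n) (alpha_basis : basis_of {:V} alpha)
    (Phi_rep : representation Phi) :
  [/\ representation (prolongation alpha Phi),
      \dim {:TV V} = (2 * n)%N
    & injective Phi -> injective (prolongation alpha Phi)].
Proof.
split; first exact: prolongation_representation.
- by rewrite dimvf mul2n -addnn -dimV !dimvf.
- exact: prolongation_inj.
Qed.
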